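(* The function $R_q$ is $m_q$-integrable, and $(\mathscr T^q,m_q,\mathrm{BCZ}_q)$ with roof function $R_q$ is a Poincaré cross section for the horocycle flow $(X_q,\mu_q,h)$, in the following sense. Let $Y=\{((a,b),s):(a,b)\in\mathscr T^q,\ 0\le s<R_q(a,b)\}$ with the suspension flow $\phi_t$ (move $s$ at unit speed, identifying $((a,b),R_q(a,b))$ with $(\mathrm{BCZ}_q(a,b),0)$), and the probability measure $\nu=\frac{1}{m_q(R_q)}\,dm_q\,ds$. Then the map $\Phi:Y\to X_q$, $\Phi((a,b),s)=h_sg_{a,b}G_q$, is a bijection onto an $h$-invariant subset of $X_q$ of full $\mu_q$-measure, satisfies $\Phi\circ\phi_t=h_t\circ\Phi$ for all $t\ge0$, and $\Phi_*\nu=\mu_q$.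
   Context: Fix an integer $q\ge3$, let $\lambda_q=2\cos(\pi/q)$, and let $G_q\subset \mathrm{SL}(2,\mathbb R)$ be the Hecke triangle group generated by $S=\begin{pmatrix}0&-1\\1&0\end{pmatrix}$ and $T_q=\begin{pmatrix}1&\lambda_q\\0&1\end{pmatrix}$ (a lattice), acting linearly on $\mathbb R^2$; $\Lambda_q=G_q(1,0)^T$. $X_q=\mathrm{SL}(2,\mathbb R)/G_q$ with $\mathrm{SL}(2,\mathbb R)$-invariant probability measure $\mu_q$, and horocycle flow $h_t(gG_q)=h_tgG_q$ where $h_s=\begin{pmatrix}1&0\\-s&1\end{pmatrix}$. $g_{a,b}=\begin{pmatrix}a&b\\0&a^{-1}\end{pmatrix}$; $S_1=\{(x,y)^T:0<x\le1\}$. $\mathscr T^q=\{(a,b):0<a\le1,\ 1-\lambda_qa<b\le1\}$ with Lebesgue probability measure $m_q=\frac{2}{\lambda_q}\,da\,db$; $m_q(R_q)=\int R_q\,dm_q$. For $(a,b)\in\mathscr T^q$, $R_q(a,b)$ is the smallest positive slope among the vectors of $g_{a,b}\Lambda_q\cap S_1=\{g_{a,b}\mathbf v:\mathbf v\in\Lambda_q\}\cap S_1$ (which exists), and $\mathrm{BCZ}_q(a,b)$ is the unique $(c,d)\in\mathscr T^q$ with $h_{R_q(a,b)}g_{a,b}\Lambda_q=g_{c,d}\Lambda_q$ (such a point exists and is unique). *)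

(* Defs.v *)
From HB Require Import structures.
From mathcomp Require Import all_boot all_order all_algebra.
From mathcomp Require Import all_classical all_reals all_analysis.
Unset Printing Implicit Defensive.
Import Order.TTheory GRing.Theory Num.Theory.
Local Open Scope classical_set_scope.
Local Open Scope ring_scope.

Section Hecke.
Variable R : realType.

Definition M2 := 'M[R]_2.
Definition ix0 : 'I_2 := @Ordinal 2 0 isT.
Definition ix1 : 'I_2 := @Ordinal 2 1 isT.
Definition mx2 (a b c d : R) : M2 :=
  \matrix_(i < 2, j < 2) if i == ix0 then (if j == ix0 then a else b)
                         else (if j == ix0 then c else d).
Definition lambdaq (q : nat) : R := 2 * cos (pi / q%:R).
Definition Smat : M2 := mx2 0 (-1) 1 0.
Definition Tmat (q : nat) : M2 := mx2 1 (lambdaq q) 0 1.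
Definition hmat (s : R) : M2 := mx2 1 0 (- s) 1.
Definition gmat (ab : R * R) : M2 := mx2 ab.1 ab.2 0 ab.1^-1.

Inductive Gq (q : nat) : M2 -> Prop :=
| Gq_one : Gq q 1
| Gq_S : Gq q Smat
| Gq_T : Gq q (Tmat q)
| Gq_mul g k : Gq q g -> Gq q k -> Gq q (g * k)
| Gq_inv g : Gq q g -> Gq q g^-1.

Definition mulv (g : M2) (v : R * R) : R * R :=
  (g ix0 ix0 * v.1 + g ix0 ix1 * v.2, g ix1 ix0 * v.1 + g ix1 ix1 * v.2).

Definition Lambdaq (q : nat) : set (R * R) := [set mulv g (1, 0) | g in Gq q].
Definition glatt (g : M2) (L : set (R * R)) : set (R * R) := mulv g @` L.

Definition Tq (q : nat) : set (R * R) :=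
  [set ab | 0 < ab.1 <= 1 /\ 1 - lambdaq q * ab.1 < ab.2 <= 1].

Definition slopes (q : nat) (ab : R * R) : set R :=
  [set v.2 / v.1 | v in [set v | glatt (gmat ab) (Lambdaq q) v /\
                                   0 < v.1 <= 1 /\ 0 < v.2 / v.1]].
Definition Rq (q : nat) (ab : R * R) : R := inf (slopes q ab).

Definition BCZq (q : nat) (ab : R * R) : R * R :=
  xget (0, 0) [set cd | Tq q cd /\
     glatt (hmat (Rq q ab) * gmat ab) (Lambdaq q) = glatt (gmat cd) (Lambdaq q)].

Definition coset (q : nat) (g : M2) : set M2 := [set g * k | k in Gq q].
Definition isCoset (q : nat) (C : set M2) : Prop :=
  exists g : M2, \det g = 1 /\ C = coset q g.
Definition Xq (q : nat) := {C : set M2 | isCoset q C}.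

Lemma coset1_isCoset (q : nat) : isCoset q (coset q 1).
Proof. by exists 1; rewrite det1. Qed.

HB.instance Definition _ q := gen_eqMixin (Xq q).
HB.instance Definition _ q := gen_choiceMixin (Xq q).
HB.instance Definition _ q :=
  isPointed.Build (Xq q) (exist _ (coset q 1) (coset1_isCoset q)).

Definition toX (q : nat) (C : set M2) : Xq q :=
  match pselect (isCoset q C) with
  | left p => exist _ C p
  | right _ => point
  end.

(* left action of g on X_q (meaningful for det g = 1) *)
Definition actX (q : nat) (g : M2) (x : Xq q) : Xq q :=
  toX q [set g * k | k in sval x].
Definition hX (q : nat) (t : R) (x : Xq q) : Xq q := actX q (hmat t) x.

(* Borel structure on X_q: A measurable iff its preimage in SL(2,R),
   viewed in R^4 = (R*R)*(R*R) through the matrix entries, is Borel *)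
Definition ofR4 (v : (R * R) * (R * R)) : M2 := mx2 v.1.1 v.1.2 v.2.1 v.2.2.
Definition preX (q : nat) (A : set (Xq q)) : set M2 :=
  [set g | \det g = 1 /\ exists2 x, A x & sval x = coset q g].
Definition Xq_borel (q : nat) : set (set (Xq q)) :=
  [set A | measurable (ofR4 @^-1` preX q A)].
Definition XqM (q : nat) := g_sigma_algebraType (Xq_borel q).

Definition SL2inv_prob (q : nat) (mu : probability (XqM q) R) : Prop :=
  forall (g : M2), \det g = 1 -> forall A : set (XqM q), measurable A ->
    mu (actX q g @` A) = mu A.

Definition Yq (q : nat) : set ((R * R) * R) :=
  [set y | Tq q y.1 /\ 0 <= y.2 < Rq q y.1].
Definition Sn (q : nat) (n : nat) (ab : R * R) : R :=
  \sum_(k < n) Rq q (iter k (BCZq q) ab).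
Definition suspflow (q : nat) (t : R) (y y' : (R * R) * R) : Prop :=
  exists n : nat, Sn q n y.1 <= y.2 + t < Sn q n.+1 y.1 /\
    y' = (iter n (BCZq q) y.1, y.2 + t - Sn q n y.1).
Definition Phiq (q : nat) (y : (R * R) * R) : XqM q :=
  toX q (coset q (hmat y.2 * gmat y.1)).

End Hecke.

(* Main.v *)
Require Import Defs.
From HB Require Import structures.
From mathcomp Require Import all_boot all_order all_algebra.
From mathcomp Require Import all_classical all_reals all_analysis.
From mathcomp Require Import measurable_realfun ring lra zify.
Import Order.TTheory GRing.Theory Num.Theory.
Import numFieldNormedType.Exports.
Local Open Scope classical_set_scope.
Local Open Scope ring_scope.

(** Put [U = T S], an elliptic element with [U^q = -1]; its powers are made of the
    numbers [u_i = sin (i pi / q) / sin (pi / q)], which are [0] or at least [1] for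
    [0 <= i <= q].  Hence [Lambda_q] is, up to rotation by multiples of [pi / 2],
    generated from [e1, e2] by matrices whose entries are [0] or at least [1], and
    every coordinate of a vector of [Lambda_q] is [0] or at least [1] in absolute
    value.  As areas of pairs of vectors of [g Lambda_q] are such coordinates, two
    distinct slopes of vectors of [g Lambda_q] in the strip [0 < x <= 1] differ by at
    least [1]; a fan [U^i e1] shows that the slopes are unbounded in both directions.
    Cutting the horocycle orbit at the largest nonpositive slope gives the bijection
    between the suspension and the cosets whose lattice meets the strip.  The cosets
    whose lattice misses the strip form a null set, since the diagonal flow moves this
    set to a decreasing sequence of sets with empty intersection and the same measure.

    In the coordinates [h_s g_(a,b)] the measure [da db ds] is proportional to the
    measure [B |-> leb (cone over B)] on 2x2 matrices, which is invariant under left and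
    right multiplication by [SL(2,R)].  Tonelli applied to the pairs [(x, y)] with [y]
    in the section and [x y] in the cone over [C], together with the left invariance of
    [mu], shows that [mu] transported to the section is proportional to [da db ds].  As
    [mu] is finite, so is the volume of the suspension, which is the integral of the roof
    function. *)

(** * Two by two matrices *)

Section Matrices.
Context {R : realType}.
Local Notation mx := (mx2 R).
Implicit Types g k : M2 R.

Lemma mx2E (a b c d : R) : (mx a b c d ix0 ix0 = a) * (mx a b c d ix0 ix1 = b) *
  (mx a b c d ix1 ix0 = c) * (mx a b c d ix1 ix1 = d).
Proof. by rewrite !mxE. Qed.

Lemma mx2_eq g k : g ix0 ix0 = k ix0 ix0 -> g ix0 ix1 = k ix0 ix1 ->
  g ix1 ix0 = k ix1 ix0 -> g ix1 ix1 = k ix1 ix1 -> g = k.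
Proof.
move=> e00 e01 e10 e11; apply/matrixP => i j.
have ord2 (l : 'I_2) : l = ix0 \/ l = ix1.
  by case: l => -[|[|//]] hl; [left|right]; exact: val_inj.
by case: (ord2 i) => ->; case: (ord2 j) => ->.
Qed.

Lemma mx2_eta g : g = mx (g ix0 ix0) (g ix0 ix1) (g ix1 ix0) (g ix1 ix1).
Proof. by apply: mx2_eq; rewrite mx2E. Qed.

Lemma mx2M_entries g k i j : (g * k) i j = g i ix0 * k ix0 j + g i ix1 * k ix1 j.
Proof.
rewrite mxE !big_ord_recl big_ord0 addr0.
by congr (g i _ * k _ j + g i _ * k _ j); exact: val_inj.
Qed.

Lemma mx2M a b c d a' b' c' d' : mx a b c d * mx a' b' c' d' =
  mx (a * a' + b * c') (a * b' + b * d') (c * a' + d * c') (c * b' + d * d').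
Proof. by apply: mx2_eq; rewrite mx2M_entries !mx2E. Qed.

Lemma mx2_1 : (1 : M2 R) = mx 1 0 0 1.
Proof. by apply: mx2_eq; rewrite mx2E mxE. Qed.

Lemma det_entries g : \det g = g ix0 ix0 * g ix1 ix1 - g ix0 ix1 * g ix1 ix0.
Proof.
rewrite (expand_det_row g ix0) !big_ord_recl big_ord0 /cofactor !det_mx11 !mxE /=.
rewrite addr0 expr0 expr1 mul1r mulN1r mulrN.
by congr (g _ _ * g _ _ - g _ _ * g _ _); exact: val_inj.
Qed.

Lemma det_mx2 a b c d : \det (mx a b c d) = a * d - b * c.
Proof. by rewrite det_entries !mx2E. Qed.

Lemma detM g k : \det (g * k) = \det g * \det k.
Proof. exact: det_mulmx. Qed.

Lemma det1_unit g : \det g = 1 -> g \is a GRing.unit.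
Proof. by move=> e; rewrite -[_ \is a _]/(_ \in unitmx) unitmxE e unitr1. Qed.

Lemma inv_entries g : \det g = 1 ->
  g^-1 = mx (g ix1 ix1) (- g ix0 ix1) (- g ix1 ix0) (g ix0 ix0).
Proof.
move=> dg; have ug := det1_unit _ dg.
apply: (mulrI ug); rewrite mulrV //; move: dg; rewrite det_entries => dg.
by apply: mx2_eq; rewrite mx2M_entries mx2_1 !mx2E; nra.
Qed.

Lemma mx2V a b c d : a * d - b * c = 1 -> (mx a b c d)^-1 = mx d (- b) (- c) a.
Proof. by move=> e; rewrite inv_entries ?det_mx2 // !mx2E. Qed.

Lemma detV1 g : \det g = 1 -> \det g^-1 = 1.
Proof.
by move=> dg; rewrite inv_entries // det_mx2 -dg det_entries; ring.
Qed.

Lemma mulvM g k v : mulv R (g * k) v = mulv R g (mulv R k v).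
Proof. by rewrite /mulv !mx2M_entries /=; congr (_, _); ring. Qed.

Lemma mulv1 v : mulv R 1 v = v.
Proof. by case: v => x y; rewrite mx2_1 /mulv !mx2E /=; congr (_, _); ring. Qed.

Lemma mulv_mx2 a b c d v :
  mulv R (mx a b c d) v = (a * v.1 + b * v.2, c * v.1 + d * v.2).
Proof. by rewrite /mulv !mx2E. Qed.

Lemma mulv_e1 g : mulv R g (1, 0) = (g ix0 ix0, g ix1 ix0).
Proof. by rewrite /mulv /=; congr (_, _); ring. Qed.

Lemma det_hmat s : \det (hmat R s) = 1.
Proof. by rewrite det_mx2; ring. Qed.

Lemma det_gmat ab : ab.1 != 0 -> \det (gmat R ab) = 1.
Proof. by move=> a0; rewrite det_mx2 mulfV //; ring. Qed.

Lemma hmatD s t : hmat R s * hmat R t = hmat R (s + t).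
Proof. by rewrite mx2M; congr (mx _ _ _ _); ring. Qed.

Lemma hmat0 : hmat R 0 = 1.
Proof. by rewrite mx2_1; congr (mx _ _ _ _); ring. Qed.

Lemma hg_mx2 ab s : hmat R s * gmat R ab =
  mx ab.1 ab.2 (- (s * ab.1)) (ab.1^-1 - s * ab.2).
Proof. by rewrite mx2M; congr (mx _ _ _ _); ring. Qed.

(** A lower unipotent factor times an upper triangular one: the first row is already that of [gmat],
    and the parameter of [hmat] has to be minus the slope of the first column. This makes
    [((a, b), s)] coordinates on the matrices with nonzero upper left entry. *)
Lemma hg_decomposition g : \det g = 1 -> g ix0 ix0 != 0 ->
  g = hmat R (- (g ix1 ix0 / g ix0 ix0)) * gmat R (g ix0 ix0, g ix0 ix1).
Proof.
rewrite det_entries => dg a0; rewrite hg_mx2 /=; apply: mx2_eq; rewrite !mx2E //.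
  by field.
apply: (mulfI a0); transitivity (1 + g ix0 ix1 * g ix1 ix0); last by field.
by rewrite -dg; ring.
Qed.

(** Shears generate [SL(2,R)]. For [c != 0] a matrix is an upper, a lower and an upper shear; for
    [c = 0], splitting off a lower shear on the right leaves a matrix with lower left entry
    [d != 0]. *)
Lemma SL2_ind (P : M2 R -> Prop) :
    (forall x, P (mx 1 x 0 1)) -> (forall x, P (mx 1 0 x 1)) ->
    (forall g k, P g -> P k -> P (g * k)) ->
  forall g, \det g = 1 -> P g.
Proof.
move=> Pu Pl PM.
have Pr a b c d : c != 0 -> a * d - b * c = 1 -> P (mx a b c d).
  move=> c0 e.
  have -> : mx a b c d = mx 1 ((a - 1) / c) 0 1 * mx 1 0 c 1 * mx 1 ((d - 1) / c) 0 1.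
    rewrite !mx2M; congr (mx _ _ _ _); try by field.
    by rewrite -[b in LHS](mulfK c0) (_ : b * c = a * d - 1); [field|rewrite -e; ring].
  exact: PM (PM _ _ _ _) _.
move=> g dg; rewrite (mx2_eta g); move: dg; rewrite det_entries.
move: (g ix0 ix0) (g ix0 ix1) (g ix1 ix0) (g ix1 ix1) => a b c d e.
have [c0|c0] := eqVneq c 0; last exact: Pr.
have d0 : d != 0 by apply: contra_eq_neq e => ->; rewrite c0 !mulr0 subr0 eq_sym oner_eq0.
have -> : mx a b c d = mx (a + b) b (c + d) d * mx 1 0 (-1) 1.
  by rewrite mx2M; congr (mx _ _ _ _); ring.
apply: PM => //; apply: Pr; first by rewrite c0 add0r.
by rewrite -e; ring.
Qed.

End Matrices.

(** * Sine ratios at multiples of [pi / q] *)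

Section Sines.
Context {R : realType}.
Variables (q : nat) (hq : (3 <= q)%N).
Local Notation theta := (pi / q%:R : R).
Local Notation lam := (lambdaq R q).

(** For [i >= 1] this is the Chebyshev polynomial of the second kind of degree [i - 1] at
    [cos theta]. The fan of [U = T S] is [U^i e1 = (u_(i+1), u_i)]. *)
Definition sineq (i : nat) : R := sin (i%:R * theta) / sin theta.
Local Notation u := sineq.

Let q_gt0 : 0 < q%:R :> R. Proof. by rewrite ltr0n; lia. Qed.

Let theta_gt0 : 0 < theta. Proof. by rewrite divr_gt0 ?pi_gt0. Qed.

Let mulq_theta : q%:R * theta = pi. Proof. by rewrite mulrC divfK ?gt_eqF. Qed.

Let lt_theta_pi i : (i <= q)%N -> i%:R * theta <= pi.
Proof. by move=> hi; rewrite -[leRHS]mulq_theta ler_pM2r // ler_nat. Qed.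

Let sin_theta_gt0 : 0 < sin theta.
Proof.
apply: sin_gt0_pi; rewrite theta_gt0 /= -[ltRHS]mulq_theta ltr_pMl //.
by rewrite ltr1n; lia.
Qed.

Lemma sineq0 : u 0 = 0.
Proof. by rewrite /u mul0r sin0 mul0r. Qed.

Lemma sineq1 : u 1 = 1.
Proof. by rewrite /u mul1r divff // gt_eqF. Qed.

Lemma sineqSS i : u i.+2 = lam * u i.+1 - u i.
Proof.
rewrite /u; have -> : i.+2%:R * theta = i.+1%:R * theta + theta.
  by rewrite -(natr1 i.+1) mulrDl mul1r.
have -> : i%:R * theta = i.+1%:R * theta - theta.
  by rewrite -(natr1 i); ring.
by rewrite sinD sinB /lambdaq; field; rewrite gt_eqF.
Qed.

Lemma sineq2 : u 2 = lam.
Proof. by rewrite sineqSS sineq1 sineq0; ring. Qed.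

Lemma sineq_q : u q = 0.
Proof. by rewrite /u mulq_theta sinpi mul0r. Qed.

Lemma sineq_q1 : u q.-1 = 1.
Proof.
rewrite /u (_ : q.-1%:R * theta = pi - theta); last first.
  have -> : q.-1%:R = q%:R - 1 :> R.
    by apply/eqP; rewrite eq_sym subr_eq natr1 prednK //; lia.
  by rewrite mulrBl mul1r mulq_theta.
by rewrite sinB sinpi cospi mul0r sub0r mulN1r opprK divff // gt_eqF.
Qed.

Lemma sineq_ge1 i : (0 < i < q)%N -> 1 <= u i.
Proof.
case/andP => i0 iq; rewrite /u ler_pdivlMr // mul1r -subr_ge0.
(* With [x] and [y] the half sum and half difference of the angles, [sin (i theta) - sin theta = 2
   cos x sin y]. Here [x <= pi / 2] because [i + 1 <= q], and [y] lies in [[0, pi]]. *)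
set x := (i%:R + 1) / 2 * theta; set y := (i%:R - 1) / 2 * theta.
have -> : i%:R * theta = x + y by rewrite /x /y; field; rewrite gt_eqF.
have -> : theta = x - y by rewrite /x /y; field; rewrite gt_eqF.
rewrite sinD sinB (_ : _ - _ = 2 * (cos x * sin y)); last by ring.
have i1 : 1 <= i%:R :> R by rewrite ler1n.
have h := lt_theta_pi i.+1 iq; rewrite -natr1 in h.
have th := theta_gt0.
apply/mulr_ge0/mulr_ge0 => //; [apply: cos_ge0_pihalf|apply: sin_ge0_pi].
  apply/andP; split; rewrite /x; last lra.
  by apply: le_trans (_ : 0 <= _); [rewrite oppr_le0 divr_ge0 ?pi_ge0|nra].
by apply/andP; split; rewrite /y; nra.
Qed.

(** Up to sign, the left side is the area spanned by two consecutive vectors of the fan, which the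
    recursion preserves. *)
Lemma sineq_det i : u i.+1 ^+ 2 - u i * u i.+2 = 1.
Proof.
elim: i => [|i <-]; first by rewrite sineq0 sineq1; ring.
by rewrite (sineqSS i.+1) (sineqSS i); ring.
Qed.

Lemma lambdaq_ge1 : 1 <= lam.
Proof. by rewrite -sineq2; apply: sineq_ge1. Qed.

Lemma lambdaq_lt2 : lam < 2.
Proof.
have i0 : (0 : R) \in `[0, pi] by rewrite in_itv /= lexx pi_ge0.
have i1 : theta \in `[0, pi].
  by rewrite in_itv /= ltW //= -[X in X <= _]mul1r; apply: (lt_theta_pi 1); lia.
by rewrite /lambdaq -[ltRHS]mulr1 ltr_pM2l // -[ltRHS]cos0 ltr_cos.
Qed.

End Sines.

(** * Arithmetic of the set Lambda_q *)

Section Lattice.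
Context {R : realType}.
Variables (q : nat) (hq : (3 <= q)%N).
Local Notation mx := (mx2 R).
Local Notation lam := (lambdaq R q).
Local Notation u := (@sineq R q).
Local Notation G := (Gq R q).
Local Notation Lam := (Lambdaq R q).
Local Notation S := (Smat R).
Local Notation T := (Tmat R q).

Let u_ge1 i : (0 < i < q)%N -> 1 <= u i := sineq_ge1 q hq i.

Let u0 : u 0 = 0 := sineq0 q.
Let u1 : u 1 = 1 := sineq1 q hq.
Let u2 : u 2 = lam := sineq2 q hq.
Let uq : u q = 0 := sineq_q q hq.
Let uq1 : u q.-1 = 1 := sineq_q1 q hq.
Let uSS i : u i.+2 = lam * u i.+1 - u i := sineqSS q hq i.

(** Step [i] is multiplication by [U^i T], which sends [e1, e2] to the consecutive fan vectors
    [U^i e1, U^(i+1) e1]. For [i < q - 1] these pairs cut the first quadrant into [q - 1] sectors,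
    as in the Farey subdivision. *)
Inductive farey : R * R -> Prop :=
| farey_e1 : farey (1, 0)
| farey_e2 : farey (0, 1)
| farey_step i v : (i < q.-1)%N -> farey v ->
    farey (u i.+1 * v.1 + u i.+2 * v.2, u i * v.1 + u i.+1 * v.2).

Definition zero_or_ge1 (x : R) := x = 0 \/ 1 <= x.

Lemma zero_or_ge1D x y : zero_or_ge1 x -> zero_or_ge1 y -> zero_or_ge1 (x + y).
Proof.
by move=> [->|x1] [->|y1]; rewrite ?add0r ?addr0; [left|right|right|right; lra].
Qed.

Lemma zero_or_ge1M x y : zero_or_ge1 x -> zero_or_ge1 y -> zero_or_ge1 (x * y).
Proof.
by move=> [->|x1] [->|y1]; rewrite ?mul0r ?mulr0; [left|left|left|right; nra].
Qed.

Lemma sineq_zero_or_ge1 i : (i <= q)%N -> zero_or_ge1 (u i).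
Proof.
case: i => [_|i]; first by left; rewrite u0.
rewrite leq_eqVlt => /orP[/eqP ->|iq]; first by left; rewrite uq.
by right; apply: u_ge1.
Qed.

Lemma farey_zero_or_ge1 v : farey v -> zero_or_ge1 v.1 /\ zero_or_ge1 v.2.
Proof.
elim=> [||i w iq _ [h1 h2]] /=; [by split; [right|left]|by split; [left|right]|].
by split; apply: zero_or_ge1D; apply: zero_or_ge1M => //;
  apply: sineq_zero_or_ge1; lia.
Qed.

Definition opv (v : R * R) : R * R := (- v.1, - v.2).
Definition rotv (v : R * R) : R * R := (- v.2, v.1).

Definition signed_farey (v : R * R) : Prop := exists2 w, farey w &
  [\/ v = w, v = opv w, v = rotv w | v = opv (rotv w)].

Lemma signed_farey_op v : signed_farey v -> signed_farey (opv v).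
Proof.
have opvK (w : R * R) : opv (opv w) = w by case: w => x y; rewrite /opv /= !opprK.
move=> [w fw [->|->|->|->]]; exists w => //.
- by constructor 2.
- by constructor 1.
- by constructor 4.
- by constructor 3.
Qed.

Lemma signed_farey_rot v : signed_farey v -> signed_farey (rotv v).
Proof.
move=> [w fw [->|->|->|->]]; exists w => //.
- by constructor 3.
- by constructor 4; rewrite /rotv /opv /= opprK.
- by constructor 2; rewrite /rotv /opv /=.
- by constructor 1; case: (w) => x y; rewrite /rotv /opv /= !opprK.
Qed.

(** [U] sends sector [i] to sector [i + 1], as [U (U^i T) = U^(i+1) T]. From the last sector,
    [i = q - 2], it leads out of the quadrant: [U^(q-1) T = S] because [U^q = -1], which gives the
    rotated case. *)
Lemma farey_U w : farey w -> signed_farey (lam * w.1 - w.2, w.1).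
Proof.
case=> [||i v iq fv] /=.
- exists (lam, 1); last by constructor 1; congr (_, _); ring.
  have := farey_step 0 (0, 1); rewrite /= u2 u1 u0 => h.
  have -> : (lam, 1) = (1 * 0 + lam * 1, 0 * 0 + 1 * 1) :> R * R by congr (_, _); ring.
  by apply: h; [lia|exact: farey_e2].
- by exists (1, 0); [exact: farey_e1|constructor 2; rewrite /opv /=; congr (_, _); ring].
have e : lam * (u i.+1 * v.1 + u i.+2 * v.2) - (u i * v.1 + u i.+1 * v.2) =
    u i.+2 * v.1 + u i.+3 * v.2.
  by rewrite (uSS i.+1) (uSS i); ring.
rewrite e; have [iq'|iq'] := ltnP i.+1 q.-1.
  by exists (u i.+2 * v.1 + u i.+3 * v.2, u i.+1 * v.1 + u i.+2 * v.2);
    [exact: farey_step|constructor 1].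
have {}iq : i.+2 = q by lia.
exists v => //; constructor 3; rewrite (uSS i.+1).
have -> : u i.+1 = 1 by rewrite (_ : i.+1 = q.-1) ?uq1 //; lia.
by rewrite iq uq /rotv; congr (_, _); ring.
Qed.

Lemma signed_farey_U v : signed_farey v -> signed_farey (lam * v.1 - v.2, v.1).
Proof.
have opU w : (lam * (opv w).1 - (opv w).2, (opv w).1) = opv (lam * w.1 - w.2, w.1).
  by rewrite /opv /=; congr (_, _); ring.
(* [rotv] is the action of [S], and [U S = T S S = - T], so this case is [farey] step 0 up to
   sign. *)
have rotU w : farey w -> signed_farey (lam * (rotv w).1 - (rotv w).2, (rotv w).1).
  move=> fw; have -> : (lam * (rotv w).1 - (rotv w).2, (rotv w).1) =
      opv (w.1 + lam * w.2, w.2) by rewrite /opv /rotv /=; congr (_, _); ring.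
  apply: signed_farey_op; exists (w.1 + lam * w.2, w.2); last by constructor 1.
  have := farey_step 0 w; rewrite u2 u1 u0 mul0r add0r !mul1r.
  by apply=> //; lia.
move=> [w fw [->|->|->|->]]; rewrite ?opU; try apply: signed_farey_op.
- exact: farey_U.
- exact: farey_U.
- exact: rotU.
- exact: rotU.
Qed.

Lemma signed_farey_T v : signed_farey v -> signed_farey (v.1 + lam * v.2, v.2).
Proof.
move=> /signed_farey_rot/signed_farey_U/signed_farey_op.
rewrite /opv /rotv /= => h.
have -> : (v.1 + lam * v.2, v.2) = (- (lam * - v.2 - v.1), - - v.2) by congr (_, _); ring.
exact: h.
Qed.

(* T^-1 = - S U^(q-1), because U = T S satisfies U^q = -1. *)
Lemma signed_farey_TV v : signed_farey v -> signed_farey (v.1 - lam * v.2, v.2).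
Proof.
move=> fv.
have fU n : signed_farey (u n.+2 * v.1 - u n.+1 * v.2, u n.+1 * v.1 - u n * v.2).
  elim: n => [|n IH].
    rewrite u2 u1 u0; have := signed_farey_U _ fv.
    by rewrite mul0r subr0 !mul1r.
  have := signed_farey_U _ IH; rewrite /= (uSS n.+1) (uSS n).
  set A := (X in signed_farey X -> _); set B := (X in _ -> signed_farey X).
  by have -> : A = B by rewrite /A /B; congr (_, _); ring.
have := fU q.-2; have eq2 : q.-2.+2 = q by lia.
have e : u q.-2 = lam.
  have := uSS q.-2.
  by rewrite eq2 uq (_ : q.-2.+1 = q.-1) ?uq1 //; [lra|lia].
rewrite eq2 (_ : q.-2.+1 = q.-1); last by lia.
rewrite uq uq1 e => /signed_farey_rot/signed_farey_op.
rewrite /opv /rotv /=.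
by congr signed_farey; congr (_, _); ring.
Qed.

(** The claim for [g^-1] is carried along because [Gq] is closed under inverses by a constructor,
    which an induction on [g] alone could not handle. *)
Lemma Gq_signed_farey g : G g -> \det g = 1 /\
  (forall v, signed_farey v -> signed_farey (mulv R g v)) /\
  (forall v, signed_farey v -> signed_farey (mulv R g^-1 v)).
Proof.
elim=> {g}.
- by rewrite det1 invr1; split => //; split => v; rewrite mulv1.
- split; first by rewrite det_mx2; ring.
  split=> v fv; rewrite ?mx2V ?mulv_mx2; try by ring.
    have := signed_farey_rot _ fv; rewrite /rotv.
    by congr signed_farey; congr (_, _); ring.
  have := signed_farey_op _ (signed_farey_rot _ fv); rewrite /rotv /opv /=.
  by congr signed_farey; congr (_, _); ring.
- split; first by rewrite det_mx2; ring.
  split=> v fv; rewrite ?mx2V ?mulv_mx2; try by ring.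
    have := signed_farey_T _ fv.
    by congr signed_farey; congr (_, _); ring.
  have := signed_farey_TV _ fv.
  by congr signed_farey; congr (_, _); ring.
- move=> g k _ [dg [hg hgV]] _ [dk [hk hkV]].
  split; first by rewrite detM dg dk mulr1.
  split=> v fv; first by rewrite mulvM; exact/hg/hk.
  by rewrite invrM ?det1_unit // mulvM; exact/hkV/hgV.
- move=> g _ [dg [hg hgV]]; split; first exact: detV1.
  by rewrite invrK.
Qed.

Lemma det_Gq g : G g -> \det g = 1.
Proof. by case/Gq_signed_farey. Qed.

Lemma Lambdaq_entries v : Lam v -> zero_or_ge1 `|v.1| /\ zero_or_ge1 `|v.2|.
Proof.
move=> [g /Gq_signed_farey [_ [h _]] <-].
have [w /farey_zero_or_ge1 [w1 w2]] : signed_farey (mulv R g (1, 0)).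
  by apply: h; exists (1, 0); [exact: farey_e1|constructor 1].
have n x : zero_or_ge1 x -> `|x| = x.
  by move=> [->|x1]; rewrite ?normr0 // ger0_norm //; lra.
by move=> [->|->|->|->]; rewrite /opv /rotv /= ?normrN !n.
Qed.

Lemma Lambdaq_mul g v : G g -> Lam v -> Lam (mulv R g v).
Proof. by move=> Gg [k Gk <-]; exists (g * k); [exact: Gq_mul|rewrite mulvM]. Qed.

Lemma Gq_Tnat n : G (mx 1 (n%:R * lam) 0 1).
Proof.
elim: n => [|n IH]; first by rewrite mul0r -mx2_1; exact: Gq_one.
have -> : mx 1 (n.+1%:R * lam) 0 1 = mx 1 (n%:R * lam) 0 1 * T.
  by rewrite mx2M -natr1; congr (mx _ _ _ _); ring.
by apply: Gq_mul => //; exact: Gq_T.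
Qed.

Lemma Gq_Tz (n : int) : G (mx 1 (n%:~R * lam) 0 1).
Proof.
case: n => n; first exact: Gq_Tnat.
have := Gq_inv _ _ _ (Gq_Tnat n.+1); rewrite mx2V; last by ring.
by congr Gq; rewrite NegzE; congr (mx _ _ _ _); rewrite ?mulrNz /=; ring.
Qed.

Lemma Lambdaq_shift (n : int) x y : Lam (x, y) -> Lam (x + n%:~R * lam * y, y).
Proof.
move/(Lambdaq_mul _ _ (Gq_Tz n)); rewrite mulv_mx2 /=.
by congr Lam; congr (_, _); ring.
Qed.

Lemma Lambdaq_e2 : Lam (0, 1).
Proof. by exists S; [exact: Gq_S|rewrite mulv_mx2 /=; congr (_, _); ring]. Qed.

Lemma Lambdaq_fan i : Lam (u i.+1, u i).
Proof.
elim: i => [|i IH].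
  exists 1; first exact: Gq_one.
  by rewrite mulv1 u1 u0.
have := Lambdaq_mul _ _ (Gq_mul _ _ _ _ (Gq_T R q) (Gq_S R q)) IH.
rewrite mulvM !mulv_mx2 /=; congr Lam; congr (_, _); last by ring.
by rewrite (uSS i); ring.
Qed.

(** Conjugation by [diag(1, -1)] exchanges [S] and [T] with their inverses, hence normalizes the
    group. It turns statements on positive slopes into statements on negative ones. *)
Lemma Gq_reflect g : G g ->
  G (mx (g ix0 ix0) (- g ix0 ix1) (- g ix1 ix0) (g ix1 ix1)).
Proof.
elim=> {g}.
- by rewrite mx2_1 !mx2E oppr0 -mx2_1; exact: Gq_one.
- have := Gq_inv _ _ _ (Gq_S R q); rewrite mx2V; last by ring.
  by congr Gq; congr (mx _ _ _ _); rewrite ?mx2E; ring.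
- have := Gq_inv _ _ _ (Gq_T R q); rewrite mx2V; last by ring.
  by congr Gq; congr (mx _ _ _ _); rewrite ?mx2E; ring.
- move=> g k _ IHg _ IHk; have := Gq_mul _ _ _ _ IHg IHk; rewrite mx2M.
  by congr Gq; congr (mx _ _ _ _); rewrite mx2M_entries; ring.
- move=> g Gg; rewrite inv_entries ?det_Gq // !mx2E => /Gq_inv; rewrite mx2V.
    by congr Gq; congr (mx _ _ _ _); ring.
  by rewrite -(det_Gq _ Gg) det_entries; ring.
Qed.

Lemma Lambdaq_reflect x y : Lam (x, y) -> Lam (x, - y).
Proof.
move=> [g /Gq_reflect Gg]; rewrite mulv_e1 => -[ex ey].
by eexists; [exact: Gg|rewrite mulv_e1 !mx2E ex ey].
Qed.

Lemma Lambdaq_short_positive (a b : R) : 0 < a <= 1 ->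
  exists x y, [/\ Lam (x, y), 0 < y & 0 < a * x + b * y <= 1].
Proof.
move=> /andP[a0 a1]; have l1 : 1 <= lam := lambdaq_ge1 _ hq.
have la0 : 0 < lam * a by nra.
(* Powers of [T] change [b] by multiples of [lam * a] and keep the heights [y], so [(a, b)] may be
   taken in [Tq]. *)
wlog bT : b / 1 - lam * a < b <= 1.
  move=> wl; pose n := Num.floor ((1 - b) / (lam * a)).
  have [|x [y [Lxy y0 h]]] := wl (b + n%:~R * (lam * a)).
    have := floor_itv ((1 - b) / (lam * a)).
    rewrite -/n ler_pdivlMr // ltr_pdivrMr // intrD mulrDl mul1r.
    by move=> /andP[h1 h2]; apply/andP; split; lra.
  exists (x + n%:~R * lam * y), y; split => //; first exact: Lambdaq_shift.
  by move: h; congr (_ && _); congr (_ _ _); ring.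
(* [f i] is the first coordinate of [g_(a,b) U^i e1]. It is above 1 at [i = 1] and equals [b <= 1]
   at [i = q - 1]; the first index at which it drops to 1 or below gives the vector. *)
pose f i := a * u i.+1 + b * u i.
have ex : exists i, (0 < i)%N && (f i <= 1).
  exists q.-1; rewrite -subn1 subn_gt0 (ltn_trans _ hq) //= subn1 /f.
  by rewrite prednK ?uq ?uq1 //; [lra|lia].
case: (ex_minnP ex) => i /andP[i0 fi1] imin.
have iq : (i <= q.-1)%N.
  apply: imin; rewrite -subn1 subn_gt0 (ltn_trans _ hq) //= subn1 /f.
  by rewrite prednK ?uq ?uq1 //; [lra|lia].
have i1 : (1 < i)%N.
  rewrite ltn_neqAle i0 andbT; apply/eqP => e; move: fi1.
  by rewrite -e /f u2 u1; lra.
exists (u i.+1), (u i); split; first exact: Lambdaq_fan.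
  by apply: lt_le_trans (u_ge1 i _) => //; lia.
rewrite -/(f i) fi1 andbT ltNge; apply/negP => fi0.
case: i i0 fi1 imin iq i1 fi0 => // i _ fi1 imin iq i1 fi0.
have fi : 1 < f i.
  by rewrite ltNge; apply/negP => h; have := imin i; rewrite h ltnn; lia.
(* If [f] jumped from above 1 to a nonpositive value, this identity, a form of [sineq_det], would
   give [a > 1]. *)
have e : a = u i.+1 * f i - u i * f i.+1.
  rewrite -[LHS]mulr1 -(sineq_det _ hq i) /f; ring.
have h1 : 1 <= u i.+1 by apply: u_ge1; lia.
have h2 : 1 <= u i by apply: u_ge1; lia.
have : 0 <= (u i.+1 - 1) * (f i - 1) by rewrite mulr_ge0 // subr_ge0 // ltW.
have : 0 <= u i * (- f i.+1) by rewrite mulr_ge0 ?oppr_ge0 //; lra.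
lra.
Qed.

Lemma Lambdaq_short_negative (a b : R) : 0 < a <= 1 ->
  exists x y, [/\ Lam (x, y), y < 0 & 0 < a * x + b * y <= 1].
Proof.
move=> /(Lambdaq_short_positive _ (- b)) [x [y [Lxy y0 h]]].
exists x, (- y); split; [exact: Lambdaq_reflect|by rewrite oppr_lt0|].
by rewrite mulrN -mulNr.
Qed.

(** Translation by multiples of [lam] brings [x] into [[0, lam)]. Both the translate and its
    distance to [lam] are then 0 or at least 1, and [lam < 2] leaves only the translate 0. *)
Lemma Lambdaq_height1 x : Lam (x, 1) -> exists n : int, x = n%:~R * lam.
Proof.
move=> Lx; have l1 : 1 <= lam := lambdaq_ge1 _ hq.
have l2 : lam < 2 := lambdaq_lt2 _ hq.
pose n := Num.floor (x / lam).
have := floor_itv (x / lam).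
rewrite -/n ler_pdivlMr ?ltr_pdivrMr; try lra.
rewrite intrD mulrDl mul1r => /andP[h1 h2].
exists n; have := Lambdaq_entries _ (Lambdaq_shift (- n) _ _ Lx).
have := Lambdaq_entries _ (Lambdaq_shift (- (n + 1)) _ _ Lx).
have e1 : (- (n + 1))%:~R = - n%:~R - 1 :> R by rewrite mulrNz intrD opprD.
have e2 : (- n)%:~R = - n%:~R :> R by rewrite mulrNz.
rewrite /= e1 e2 => -[H1 _] [H2 _].
move: H1 H2; rewrite ler0_norm; last lra.
rewrite ger0_norm; last lra.
by move=> [?|?] [?|?]; lra.
Qed.

End Lattice.

(** * The cross section *)

(** An element within distance 1 of the infimum has no room for a smaller one below it. *)
Lemma separated_has_min {R : realType} (A : set R) : A !=set0 ->
  (exists l, forall x, A x -> l <= x) ->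
  (forall x y, A x -> A y -> x < y -> 1 <= y - x) ->
  exists2 m, A m & forall x, A x -> m <= x.
Proof.
move=> A0 [l hl] sep; have hA : has_inf A by split => //; exists l.
have [m Am mlt] := inf_adherent ltr01 hA.
exists m => // x Ax; rewrite leNgt; apply/negP => xm.
have := sep _ _ Ax Am xm; have := ge_inf hA.2 Ax; lra.
Qed.

Lemma separated_has_max {R : realType} (A : set R) : A !=set0 ->
  (exists l, forall x, A x -> x <= l) ->
  (forall x y, A x -> A y -> x < y -> 1 <= y - x) ->
  exists2 m, A m & forall x, A x -> x <= m.
Proof.
move=> [a Aa] [l hl] sep.
have [|||m Am mmin] := @separated_has_min R [set x | A (- x)].
- by exists (- a); rewrite /= opprK.
- by exists (- l) => x /hl; rewrite lerNl.
- by move=> x y Ax Ay xy; have := sep _ _ Ay Ax; rewrite ltrN2 opprK addrC => /(_ xy).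
by exists (- m) => // x Ax; have := mmin (- x); rewrite /= opprK lerNr; exact.
Qed.

Section Dynamics.
Context {R : realType}.
Variables (q : nat) (hq : (3 <= q)%N).
Local Notation mx := (mx2 R).
Local Notation lam := (lambdaq R q).
Local Notation G := (Gq R q).
Local Notation Lam := (Lambdaq R q).
Local Notation T := (Tmat R q).
Local Notation h := (hmat R).
Local Notation gm := (gmat R).
Local Notation lat g := (glatt R g (Lambdaq R q)).
Implicit Types g k : M2 R.

Lemma glatt_columnP g v :
  lat g v <-> exists2 k, G k & v = ((g * k) ix0 ix0, (g * k) ix1 ix0).
Proof.
split=> [[_ [k Gk <-] <-]|[k Gk ->]].
  by exists k => //; rewrite -mulvM mulv_e1.
by exists (mulv R k (1, 0)); [exists k|rewrite -mulvM mulv_e1].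
Qed.

Lemma glatt_mulG g k : G k -> lat (g * k) = lat g.
Proof.
move=> Gk; apply/seteqP; split => v [w Lw <-].
  by exists (mulv R k w); [exact: Lambdaq_mul|rewrite mulvM].
exists (mulv R k^-1 w); first by apply: Lambdaq_mul => //; exact: Gq_inv.
by rewrite -mulvM mulrK // det1_unit // (det_Gq _ hq).
Qed.

Lemma coset_mulG g k : G k -> coset R q (g * k) = coset R q g.
Proof.
move=> Gk; apply/seteqP; split => x [m Gm <-].
  by exists (k * m); [exact: Gq_mul|rewrite mulrA].
exists (k^-1 * m); first by apply: Gq_mul => //; exact: Gq_inv.
by rewrite mulrA mulrK // det1_unit // (det_Gq _ hq).
Qed.

Lemma coset_eqP g g' : coset R q g = coset R q g' <-> exists2 k, G k & g' = g * k.
Proof.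
split=> [e|[k Gk ->]]; last by rewrite coset_mulG.
have : coset R q g' g' by exists 1; [exact: Gq_one|rewrite mulr1].
by rewrite -e => -[k Gk <-]; exists k.
Qed.

Lemma coset_glatt g g' : coset R q g = coset R q g' -> lat g = lat g'.
Proof. by move=> /coset_eqP [k Gk ->]; rewrite glatt_mulG. Qed.

Lemma coset_mull k g g' : coset R q g = coset R q g' ->
  coset R q (k * g) = coset R q (k * g').
Proof. by move=> /coset_eqP [m Gm ->]; apply/coset_eqP; exists m; rewrite ?mulrA. Qed.

(** This links [BCZq], defined through lattices, to the cosets of [X_q]. After right multiplication
    by some [k] both matrices have the same first column, so they differ by a unipotent [m] fixing
    [e1]; as [m e2] lies in [Lambda_q] at height 1, [m] is a power of [T]. *)
Lemma glatt_coset g g' : \det g = 1 -> \det g' = 1 -> lat g = lat g' ->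
  coset R q g = coset R q g'.
Proof.
move=> dg dg' e; have ug := det1_unit _ dg.
have [k Gk ek] : exists2 k, G k & mulv R g' (1, 0) = mulv R (g * k) (1, 0).
  have : lat g' (mulv R g' (1, 0)).
    by exists (1, 0) => //; exists 1; [exact: Gq_one|rewrite mulv1].
  by rewrite -e glatt_columnP => -[k Gk ek]; exists k => //; rewrite ek mulv_e1.
have dk := det_Gq _ hq _ Gk; have uk := det1_unit _ dk.
have dgk : \det (g * k) = 1 by rewrite detM dg dk mulr1.
pose m := (g * k)^-1 * g'.
have dm : \det m = 1 by rewrite detM detV1 // dg' mulr1.
have g'E : g' = (g * k) * m by rewrite mulrA mulrV ?mul1r // det1_unit.
have : mulv R m (1, 0) = (1, 0).
  by rewrite mulvM ek -mulvM mulVr ?mulv1 // det1_unit.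
rewrite mulv_e1 => -[m00 m10].
have m11 : m ix1 ix1 = 1 by move: dm; rewrite det_entries m00 m10; lra.
have mE : m = mx 1 (m ix0 ix1) 0 1 by rewrite {1}[m]mx2_eta m00 m10 m11.
have Lm : Lam (m ix0 ix1, 1).
  have : lat g' (mulv R g' (0, 1)) by exists (0, 1) => //; exact: Lambdaq_e2.
  rewrite -e -(glatt_mulG _ k) // {1}g'E mulvM => -[v Lv].
  move/(congr1 (mulv R (g * k)^-1)).
  rewrite -!mulvM mulVr ?det1_unit // mul1r !mulv1 mE mulv_mx2 !mx2E /=.
  by rewrite !mulr0 !mulr1 !add0r => <-.
have [n nE] := Lambdaq_height1 _ hq _ Lm.
apply/coset_eqP; exists (k * m); last by rewrite mulrA.
by apply: Gq_mul => //; rewrite mE nE; exact: Gq_Tz.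
Qed.

(** The area [D] is the lower left entry of [m = k^-1 l], that is, a coordinate of a vector of
    [Lambda_q]. If it vanishes, the diagonal entries of [m] have product 1 and absolute value at
    least 1, so both are the same sign. *)
Lemma glatt_det g v w : \det g = 1 -> lat g v -> lat g w ->
  let D := v.1 * w.2 - v.2 * w.1 in
  1 <= `|D| \/ (D = 0 /\ (w = v \/ w = opv v)).
Proof.
move=> dg /glatt_columnP[k Gk vE] /glatt_columnP[l Gl wE] D.
have dk := det_Gq _ hq _ Gk; have uk := det1_unit _ dk.
have dl := det_Gq _ hq _ Gl.
pose m := k^-1 * l; have Gm : G m by apply: Gq_mul => //; exact: Gq_inv.
have dm := det_Gq _ hq _ Gm.
have glE : g * l = g * k * m by rewrite mulrA mulrK.
have dgk : \det (g * k) = 1 by rewrite detM dg dk mulr1.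
have w1 : w.1 = (g * k) ix0 ix0 * m ix0 ix0 + (g * k) ix0 ix1 * m ix1 ix0.
  by rewrite wE glE /= mx2M_entries.
have w2 : w.2 = (g * k) ix1 ix0 * m ix0 ix0 + (g * k) ix1 ix1 * m ix1 ix0.
  by rewrite wE glE /= mx2M_entries.
have DE : D = m ix1 ix0.
  rewrite -[RHS]mul1r -dgk det_entries /D w1 w2 vE /=; ring.
have Lm : Lam (m ix0 ix0, m ix1 ix0) by exists m => //; rewrite mulv_e1.
have Lm' : Lam (m ix1 ix1, - m ix1 ix0).
  exists m^-1; first exact: Gq_inv.
  by rewrite mulv_e1 inv_entries // !mx2E.
have [h1 [|]] := Lambdaq_entries _ hq _ Lm; rewrite -?DE /=; last by left.
move/normr0P/eqP => D0; right; split => //.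
have [h2 _] := Lambdaq_entries _ hq _ Lm'.
move: dm; rewrite det_entries -DE D0 mulr0 subr0 => dm.
have {h1 h2} : m ix0 ix0 = 1 \/ m ix0 ix0 = - 1.
  have a0 : m ix0 ix0 != 0.
    by apply: contra_eq_neq dm => ->; rewrite mul0r eq_sym oner_eq0.
  have d0 : m ix1 ix1 != 0.
    by apply: contra_eq_neq dm => ->; rewrite mulr0 eq_sym oner_eq0.
  case: h1 => [/normr0P/eqP/eqP|] /=; first by rewrite (negbTE a0).
  case: h2 => [/normr0P/eqP/eqP|] /=; first by rewrite (negbTE d0).
  move=> d1 a1; have : `|m ix0 ix0| = 1.
    have : `|m ix0 ix0| * `|m ix1 ix1| = 1 by rewrite -normrM dm normr1.
    by nra.
  by case: ger0P => _ <-; [left|right; rewrite opprK].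
move=> mE; move: vE; case: (v) (w) w1 w2 => [v1 v2] [w1 w2] /= -> -> [-> ->].
rewrite -DE D0 !mulr0 !addr0.
by case: mE => ->; [left|right]; rewrite /opv /= ?mulr1 ?mulrN1.
Qed.

(** Unlike [slopes], slopes of every sign are kept, so that [h_s] acts by the translation
    [t |-> t - s]. *)
Definition slopeset g : set R :=
  [set v.2 / v.1 | v in [set v | lat g v /\ 0 < v.1 <= 1]].

(** The difference of the slopes is the area of the two vectors divided by the product of their
    first coordinates, and that product is at most 1. *)
Lemma slopeset_sep g s t : \det g = 1 -> slopeset g s -> slopeset g t ->
  s < t -> 1 <= t - s.
Proof.
move=> dg [v [Lv /andP[v0 v1]] <-] [w [Lw /andP[w0 w1]] <-] st.
have vw0 : 0 < v.1 * w.1 by nra.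
have e : v.1 * w.2 - v.2 * w.1 = (w.2 / w.1 - v.2 / v.1) * (v.1 * w.1).
  by field; rewrite !gt_eqF.
have p : 0 < w.2 / w.1 - v.2 / v.1 by rewrite subr_gt0.
have := glatt_det _ _ _ dg Lv Lw; rewrite e /= => -[|[D0 _]].
  rewrite ger0_norm; last by rewrite mulr_ge0 // ltW.
  have : v.1 * w.1 <= 1 by nra.
  by move: p vw0; set x := _ - _; set y := v.1 * w.1; nra.
by have := mulr_gt0 p vw0; rewrite D0 ltxx.
Qed.

Lemma slopeset_h s g t : slopeset (h s * g) t <-> slopeset g (t + s).
Proof.
have hv v : mulv R (h s) v = (v.1, v.2 - s * v.1).
  by rewrite mulv_mx2; congr (_, _); ring.
have hv' v : mulv R (h s) (v.1, v.2 + s * v.1) = v.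
  by case: v => x y; rewrite hv /=; congr (_, _); ring.
split=> [[v [[w Lw <-]]]|[v [[w Lw <-]]]].
  rewrite mulvM hv /= => v01 <-; exists (mulv R g w) => //=.
    by split => //; exists w.
  by field; rewrite gt_eqF //; case/andP: v01.
move=> v01 e; exists (mulv R (h s * g) w).
  by split; [exists w|rewrite mulvM hv].
rewrite -[RHS](addrK s) -e mulvM hv; move: (mulv R g w) v01 => z v01 /=.
by field; rewrite gt_eqF //; case/andP: v01.
Qed.

Lemma slopes_slopeset ab : slopes R q ab = [set t | slopeset (gm ab) t /\ 0 < t].
Proof.
apply/seteqP; split => t /=.
  by move=> [v /= [Lv [v1 v2]] <-]; split => //; exists v.
by move=> [[v [Lv v01] <-] t0]; exists v.
Qed.

Lemma Tq_shift (a b : R) : 0 < a <= 1 ->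
  exists n : int, Tq R q (a, b + n%:~R * (lam * a)).
Proof.
move=> a01; have l1 : 1 <= lam := lambdaq_ge1 _ hq.
have la0 : 0 < lam * a by case/andP: a01 => ? ?; nra.
exists (Num.floor ((1 - b) / (lam * a))); set n := Num.floor _.
split => //=; have := floor_itv ((1 - b) / (lam * a)).
rewrite -/n ler_pdivlMr // ltr_pdivrMr // intrD mulrDl mul1r.
by move=> /andP[h1 h2]; apply/andP; split; lra.
Qed.

(** Choose the representative of the coset with first column [v] and factor it by
    [hg_decomposition]. A further power of [T] on the right shifts the second coordinate by
    multiples of [lam * v.1], the length of the fiber of [Tq]. *)
Lemma coset_normal_form g v : \det g = 1 -> lat g v -> 0 < v.1 <= 1 ->
  exists2 b, Tq R q (v.1, b) &
    coset R q (h (- (v.2 / v.1)) * gm (v.1, b)) = coset R q g.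
Proof.
move=> dg /glatt_columnP[k Gk vE] v01.
have dk := det_Gq _ hq _ Gk.
have dgk : \det (g * k) = 1 by rewrite detM dg dk mulr1.
have [n nT] := Tq_shift v.1 ((g * k) ix0 ix1) v01.
exists ((g * k) ix0 ix1 + n%:~R * (lam * v.1)) => //; symmetry; apply/coset_eqP.
exists (k * mx 1 (n%:~R * lam) 0 1); first by apply: Gq_mul => //; exact: Gq_Tz.
have v0 : v.1 != 0 by rewrite gt_eqF //; case/andP: v01.
have gk0 : (g * k) ix0 ix0 = v.1 by rewrite vE.
have gk1 : (g * k) ix1 ix0 = v.2 by rewrite vE.
rewrite mulrA {2}(hg_decomposition _ dgk) ?gk0 ?gk1 // -mulrA; congr (_ * _).
by rewrite mx2M; congr (mx _ _ _ _) => /=; field.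
Qed.

(** In normal form the given slope becomes 0, and a short vector of positive height has positive
    slope. *)
Lemma slopeset_up g s : \det g = 1 -> slopeset g s -> exists2 t, slopeset g t & s < t.
Proof.
move=> dg [v [Lv v01] <-]; have [b bT /coset_glatt e] := coset_normal_form _ _ dg Lv v01.
have [x [y [Lxy y0 f01]]] := Lambdaq_short_positive _ hq _ b v01.
have v0 : 0 < v.1 by case/andP: v01.
have : slopeset (gm (v.1, b)) ((y / v.1) / (v.1 * x + b * y)).
  exists (mulv R (gm (v.1, b)) (x, y)); last by rewrite mulv_mx2 /=; congr (_ / _); ring.
  by split; [exists (x, y)|rewrite mulv_mx2].
set t := _ / _ => tS; exists (t + v.2 / v.1); last first.
  by rewrite ltrDr !divr_gt0 //; case/andP: f01.
have := (slopeset_h (- (v.2 / v.1)) (gm (v.1, b)) (t + v.2 / v.1)).2.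
by rewrite addrK /slopeset e; apply.
Qed.

Lemma slopeset_down g s : \det g = 1 -> slopeset g s -> exists2 t, slopeset g t & t < s.
Proof.
move=> dg [v [Lv v01] <-]; have [b bT /coset_glatt e] := coset_normal_form _ _ dg Lv v01.
have [x [y [Lxy y0 f01]]] := Lambdaq_short_negative _ hq _ b v01.
have v0 : 0 < v.1 by case/andP: v01.
have : slopeset (gm (v.1, b)) ((y / v.1) / (v.1 * x + b * y)).
  exists (mulv R (gm (v.1, b)) (x, y)); last by rewrite mulv_mx2 /=; congr (_ / _); ring.
  by split; [exists (x, y)|rewrite mulv_mx2].
set t := _ / _ => tS; exists (t + v.2 / v.1); last first.
  rewrite gtrDr /t -oppr_gt0 -!mulNr !divr_gt0 ?oppr_gt0 //; by case/andP: f01.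
have := (slopeset_h (- (v.2 / v.1)) (gm (v.1, b)) (t + v.2 / v.1)).2.
by rewrite addrK /slopeset e; apply.
Qed.

Lemma Tq_gt0 ab : Tq R q ab -> 0 < ab.1.
Proof. by case=> /andP[]. Qed.

Lemma det_hg y : Tq R q y.1 -> \det (h y.2 * gm y.1) = 1.
Proof. by move=> /Tq_gt0 a0; rewrite detM det_hmat det_gmat ?mulr1 // gt_eqF. Qed.

Lemma det_gT ab : Tq R q ab -> \det (gm ab) = 1.
Proof. by move=> /Tq_gt0 a0; rewrite det_gmat // gt_eqF. Qed.

Lemma slopeset_gm ab : Tq R q ab -> slopeset (gm ab) 0.
Proof.
move=> Tab; exists (mulv R (gm ab) (1, 0)); last by rewrite mulv_e1 !mx2E mul0r.
split; last by rewrite mulv_e1 !mx2E; case: Tab.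
by exists (1, 0) => //; exists 1; [exact: Gq_one|rewrite mulv1].
Qed.

(** The infimum is attained: positive slopes exist above the slope 0 of the image of [e1], and they
    are 1-separated. *)
Lemma Rq_min ab : Tq R q ab -> slopes R q ab (Rq R q ab) /\
  forall t, slopes R q ab t -> Rq R q ab <= t.
Proof.
move=> Tab; have dg := det_gT _ Tab.
have [|||m mS mmin] := separated_has_min (slopes R q ab).
- have [t tS t0] := slopeset_up _ _ dg (slopeset_gm _ Tab).
  by exists t; rewrite slopes_slopeset.
- by exists 0 => x; rewrite slopes_slopeset => -[_ /ltW].
- move=> x y; rewrite slopes_slopeset => -[xS _] [yS _].
  exact: slopeset_sep dg xS yS.
suff -> : Rq R q ab = m by [].
apply/eqP; rewrite eq_le; apply/andP; split.
  by apply: ge_inf => //; exists m.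
by apply: lb_le_inf => //; exists m.
Qed.

Lemma Rq_ge1 ab : Tq R q ab -> 1 <= Rq R q ab.
Proof.
move=> Tab; have [] := Rq_min _ Tab; rewrite slopes_slopeset => -[RS R0] _.
by have := slopeset_sep _ _ _ (det_gT _ Tab) (slopeset_gm _ Tab) RS R0; rewrite subr0.
Qed.

(** With [m] the largest nonpositive slope, [s = - m] is the time elapsed since the last visit to
    the section. The slope [m + Rq] also belongs to [g], so it must be positive, which is
    [s < Rq]. *)
Lemma Yq_section g : \det g = 1 -> slopeset g !=set0 ->
  exists2 y, Yq R q y & coset R q (h y.2 * gm y.1) = coset R q g.
Proof.
move=> dg [s0 s0S].
have sep x y : slopeset g x -> slopeset g y -> x < y -> 1 <= y - x.
  exact: slopeset_sep dg.
have [|||m [mS m0] mmax] := separated_has_max [set s | slopeset g s /\ s <= 0].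
(* Without a nonpositive slope, separation would yield a least slope, contradicting
   [slopeset_down]. *)
- apply: contrapT => /forallNP no.
  have pos x : slopeset g x -> 0 <= x.
    by move=> xS; rewrite leNgt; apply/negP => /ltW x0; apply: (no x).
  have [||m mS mmin] := separated_has_min (slopeset g) _ _ sep.
  + by exists s0.
  + by exists 0.
  have [t tS] := slopeset_down _ _ dg mS.
  by rewrite ltNge mmin.
- by exists 0 => x [].
- by move=> x y [xS _] [yS _]; exact: sep.
have [v [Lv v01] vm] := mS.
have [b bT e] := coset_normal_form _ _ dg Lv v01.
exists ((v.1, b), - m); last by rewrite /= -vm.
split=> //=; rewrite oppr_ge0 m0 /=.
have [] := Rq_min _ bT; rewrite slopes_slopeset => -[RS R0] _.
rewrite ltNge; apply/negP => Rm.
have RmS : slopeset g (Rq R q (v.1, b) + m).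
  rewrite /slopeset -(coset_glatt _ _ e).
  by apply/slopeset_h; rewrite vm addrK.
have Rm0 : Rq R q (v.1, b) + m <= 0 by lra.
have := mmax _ (conj RmS Rm0); lra.
Qed.

Lemma Yq_inj y y' : Yq R q y -> Yq R q y' ->
  coset R q (h y.2 * gm y.1) = coset R q (h y'.2 * gm y'.1) -> y = y'.
Proof.
(* If [z.2 < z'.2], the difference would be a positive slope for [z'.1] below its return time. *)
have le_slope z z' : Yq R q z -> Yq R q z' ->
    coset R q (h z.2 * gm z.1) = coset R q (h z'.2 * gm z'.1) -> z'.2 <= z.2.
  move=> [Tz /andP[z0 zR]] [Tz' /andP[z0' zR']] e; rewrite leNgt; apply/negP => zz'.
  have : slopeset (gm z'.1) (z'.2 - z.2).
    have : slopeset (h z.2 * gm z.1) (- z.2).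
      by apply/slopeset_h; rewrite addNr; exact: slopeset_gm.
    by rewrite /slopeset (coset_glatt _ _ e) => /slopeset_h; rewrite addrC.
  move=> S; have [_ /(_ (z'.2 - z.2))] := Rq_min _ Tz'.
  by rewrite slopes_slopeset => /(_ (conj S _)); rewrite subr_gt0 => /(_ zz'); lra.
move=> Yy Yy' e; have es : y.2 = y'.2.
  by apply/eqP; rewrite eq_le (le_slope _ _ Yy Yy' e) (le_slope _ _ Yy' Yy (esym e)).
clear le_slope.
have {}e : coset R q (gm y.1) = coset R q (gm y'.1).
  have := coset_mull (h (- y.2)) _ _ e.
  by rewrite !mulrA -es !hmatD addNr hmat0 !mul1r.
have [k Gk kE] := (coset_eqP _ _).1 e.
case: Yy Yy' => Ty _ [Ty' _].
have a0 := Tq_gt0 _ Ty; have a0' := Tq_gt0 _ Ty'.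
have dg := det_gT _ Ty.
(* Both horizontal vectors lie in the same lattice and span area 0, so they agree up to sign, and
   positivity fixes the sign. *)
have [||D1|[_ ve]] := glatt_det (gm y.1) (y.1.1, 0) (y'.1.1, 0) dg.
- by exists (1, 0); [exists 1; [exact: Gq_one|rewrite mulv1]|rewrite mulv_e1 !mx2E].
- rewrite (coset_glatt _ _ e).
  by exists (1, 0); [exists 1; [exact: Gq_one|rewrite mulv1]|rewrite mulv_e1 !mx2E].
- by move: D1; rewrite /= mulr0 mul0r subr0 normr0 ler10.
have ea : y'.1.1 = y.1.1.
  by case: ve => [[-> //]|[]] /=; move: a0 a0'; move: y.1.1 y'.1.1 => a a' *; lra.
have : k = mx 1 ((y'.1.2 - y.1.2) / y.1.1) 0 1.
  apply: (mulrI (det1_unit _ dg)); rewrite -kE mx2M /gmat ea.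
  by congr (mx _ _ _ _) => /=; field; rewrite ?gt_eqF.
move=> kE'; have Lx : Lam ((y'.1.2 - y.1.2) / y.1.1, 1).
  have := Lambdaq_mul q _ _ Gk (Lambdaq_e2 q); rewrite kE' mulv_mx2 /=.
  by congr Lambdaq; congr (_, _); ring.
have [n nE] := Lambdaq_height1 _ hq _ Lx.
have l1 : 1 <= lam := lambdaq_ge1 _ hq.
have {}nE : y'.1.2 - y.1.2 = n%:~R * (lam * y.1.1).
  by rewrite mulrA -nE divfK // gt_eqF.
case: Ty Ty' => _ /andP[b1 b2] [_]; rewrite ea => /andP[b1' b2'].
have la0 : 0 < lam * y.1.1 by nra.
(* Both second coordinates lie in the half-open interval [(1 - lam * a, 1]] of length [lam * a]. *)
have n0 : n = 0.
  have : (n%:~R < 1%:~R :> R) by rewrite -(ltr_pM2r la0) -nE mul1r; lra.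
  have : ((-1)%:~R < n%:~R :> R) by rewrite -(ltr_pM2r la0) -nE mulN1r; lra.
  by rewrite !ltr_int; lia.
have eb : y'.1.2 = y.1.2 by move: nE; rewrite n0 mul0r; lra.
by case: y y' es ea eb {e kE dg Lx Gk ve kE' nE a0 a0' b1 b2 b1' b2' la0} =>
  [[? ?] ?] [[? ?] ?] /= -> -> ->.
Qed.

Lemma BCZq_spec ab : Tq R q ab -> Tq R q (BCZq R q ab) /\
  coset R q (h (Rq R q ab) * gm ab) = coset R q (gm (BCZq R q ab)).
Proof.
move=> Tab; have dg := det_gT _ Tab.
have dhg : \det (h (Rq R q ab) * gm ab) = 1 by rewrite detM det_hmat dg mulr1.
have [] : [set cd | Tq R q cd /\ lat (h (Rq R q ab) * gm ab) = lat (gm cd)]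
    (BCZq R q ab).
  rewrite /BCZq; case: xgetP => [cd -> //|no].
  (* At time [Rq] the minimal positive slope has moved to 0. The normal form at slope 0 then has no
     [h] factor and provides a point of [Tq], so [xget] does not return its default. *)
  have [] := Rq_min _ Tab; rewrite slopes_slopeset => -[RS _] _.
  have : slopeset (h (Rq R q ab) * gm ab) 0 by apply/slopeset_h; rewrite add0r.
  move=> [v [Lv v01] e0]; have [b bT e] := coset_normal_form _ _ dhg Lv v01.
  case: (no (v.1, b)); split => //; rewrite -(coset_glatt _ _ e).
  by rewrite e0 oppr0 hmat0 mul1r.
by move=> Tcd e; split => //; apply: glatt_coset => //; exact: det_gT.
Qed.

Lemma iter_BCZq n ab : Tq R q ab -> Tq R q (iter n (BCZq R q) ab) /\
  coset R q (h (Sn R q n ab) * gm ab) = coset R q (gm (iter n (BCZq R q) ab)).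
Proof.
move=> Tab; elim: n => [|n [Tn en]].
  by rewrite /Sn big_ord0 hmat0 mul1r.
have [TB eB] := BCZq_spec _ Tn; split => //.
rewrite iterS -eB /Sn big_ord_recr /= -/(Sn R q n ab) addrC -hmatD -mulrA.
exact: coset_mull.
Qed.

(** Return times of at least 1 prevent infinitely many returns in finite time; hence the suspension
    flow is defined for all [t >= 0]. *)
Lemma Sn_ge n ab : Tq R q ab -> n%:R <= Sn R q n ab.
Proof.
move=> Tab; elim: n => [|n IH]; first by rewrite /Sn big_ord0.
rewrite /Sn big_ord_recr /= -/(Sn R q n ab) -natr1 lerD //.
by apply: Rq_ge1; case: (iter_BCZq n _ Tab).
Qed.

Lemma suspflow_exists t y : 0 <= t -> Yq R q y -> exists y', suspflow R q t y y'.
Proof.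
move=> t0 [Ty /andP[y0 _]].
have ex : exists n, y.2 + t < Sn R q n.+1 y.1.
  exists (Num.truncn (y.2 + t)); apply: lt_le_trans (Sn_ge _ _ Ty).
  by rewrite truncnS_gt.
case: (ex_minnP ex) => n hn nmin.
exists (iter n (BCZq R q) y.1, y.2 + t - Sn R q n y.1), n; split => //.
rewrite hn andbT; case: n hn nmin => [|n] hn nmin.
  by rewrite /Sn big_ord0 addr_ge0.
by rewrite leNgt; apply/negP => /nmin; rewrite ltnn.
Qed.

Lemma suspflow_coset t y y' : Yq R q y -> suspflow R q t y y' ->
  coset R q (h y'.2 * gm y'.1) = coset R q (h t * (h y.2 * gm y.1)) /\ Tq R q y'.1.
Proof.
move=> [Ty _] [n [_ ->]] /=; have [Tn en] := iter_BCZq n _ Ty; split => //.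
rewrite -(coset_mull _ _ _ en) !mulrA !hmatD.
by congr (coset R q (h _ * _)); ring.
Qed.

Lemma isCoset_coset g : \det g = 1 -> isCoset R q (coset R q g).
Proof. by move=> dg; exists g. Qed.

Lemma sval_toX g : \det g = 1 -> sval (toX R q (coset R q g)) = coset R q g.
Proof.
by move=> /isCoset_coset ig; rewrite /toX; case: pselect.
Qed.

Lemma Xq_repr (x : Xq R q) : exists2 g, \det g = 1 & x = toX R q (coset R q g).
Proof.
case: x => C p; have [g [dg e]] := p; exists g => //; subst C.
rewrite /toX; case: pselect => [p'|[]]; last exact: isCoset_coset.
by congr exist; exact: Prop_irrelevance.
Qed.

Lemma toX_inj g k : \det g = 1 -> \det k = 1 ->
  toX R q (coset R q g) = toX R q (coset R q k) -> coset R q g = coset R q k.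
Proof. by move=> dg dk /(congr1 sval); rewrite !sval_toX. Qed.

Lemma actX_toX g k : \det k = 1 ->
  actX R q g (toX R q (coset R q k)) = toX R q (coset R q (g * k)).
Proof.
move=> dk; rewrite /actX sval_toX //; congr toX; apply/seteqP; split => x.
  by move=> [_ [m Gm <-] <-]; exists m; rewrite ?mulrA.
by move=> [m Gm <-]; exists (k * m); [exists m|rewrite mulrA].
Qed.

Lemma Phiq_suspflow t y y' : Yq R q y -> suspflow R q t y y' ->
  Phiq R q y' = hX R q t (Phiq R q y).
Proof.
move=> Yy sf; have [e Ty'] := suspflow_coset _ _ _ Yy sf; case: Yy => Ty _.
by rewrite /hX /Phiq actX_toX ?det_hg // e.
Qed.

Lemma Phiq_inj y y' : Yq R q y -> Yq R q y' -> Phiq R q y = Phiq R q y' -> y = y'.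
Proof.
move=> Yy Yy' e; apply: Yq_inj => //; apply: toX_inj e; apply: det_hg.
  by case: Yy.
by case: Yy'.
Qed.

Lemma Phiq_image g : \det g = 1 ->
  (Phiq R q @` Yq R q) (toX R q (coset R q g)) <-> slopeset g !=set0.
Proof.
move=> dg; split=> [[y [Ty yR] e]|/(Yq_section _ dg) [y Yy e]]; last first.
  by exists y => //; rewrite /Phiq e.
have e' := toX_inj _ _ (det_hg _ Ty) dg e.
exists (- y.2); rewrite /slopeset -(coset_glatt _ _ e').
by apply/slopeset_h; rewrite addNr; exact: slopeset_gm.
Qed.

End Dynamics.

(** * Invariant measures *)

Lemma measurable_fun_fst_comp d d1 d2 (T : measurableType d) (T1 : measurableType d1)
    (T2 : measurableType d2) (f : T -> T1 * T2) :
  measurable_fun setT f -> measurable_fun setT (fun x => (f x).1).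
Proof. by move=> mf; exact: (measurableT_comp measurable_fst). Qed.

Lemma measurable_fun_snd_comp d d1 d2 (T : measurableType d) (T1 : measurableType d1)
    (T2 : measurableType d2) (f : T -> T1 * T2) :
  measurable_fun setT f -> measurable_fun setT (fun x => (f x).2).
Proof. by move=> mf; exact: (measurableT_comp measurable_snd). Qed.

Lemma measurable_fun_inv {R : realType} : measurable_fun setT (@GRing.inv R).
Proof.
have -> : [set: R] = [set 0] `|` ~` [set 0] by rewrite setUv.
apply/measurable_funU => //; first exact: measurableC.
split; first exact: measurable_fun_set1.
apply: open_continuous_measurable_fun; first exact/closed_openC/closed_eq.
by move=> x /set_mem x0; apply: inv_continuous; exact/eqP.
Qed.

Lemma measurable_fun_inv_comp d (T : measurableType d) {R : realType} (f : T -> R) :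
  measurable_fun setT f -> measurable_fun setT (fun x => (f x)^-1).
Proof. by move=> mf; exact: (measurableT_comp measurable_fun_inv). Qed.

Lemma measurable_fun_sqrt_comp d (T : measurableType d) {R : realType} (f : T -> R) :
  measurable_fun setT f -> measurable_fun setT (fun x => Num.sqrt (f x)).
Proof.
move=> mf; apply: (measurableT_comp (f := @Num.sqrt R)) => //.
by apply: continuous_measurable_fun; exact: sqrt_continuous.
Qed.

Ltac mfun := repeat match goal with
| |- measurable_fun _ (fun _ => (_, _)) => apply: measurable_fun_pair
| |- measurable_fun _ (fun _ => _ + - _) => apply: measurable_funB
| |- measurable_fun _ (fun _ => _ + _) => apply: measurable_funD
| |- measurable_fun _ (fun _ => _ * _) => apply: measurable_funM
| |- measurable_fun _ (fun _ => - _) => apply: measurable_funN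
| |- measurable_fun _ (fun _ => (_)^-1) => apply: measurable_fun_inv_comp
| |- measurable_fun _ (fun _ => Num.sqrt _) => apply: measurable_fun_sqrt_comp
| |- measurable_fun _ (fun x => x) => exact: measurable_id
| |- measurable_fun _ (@fst _ _) => exact: measurable_fst
| |- measurable_fun _ (@snd _ _) => exact: measurable_snd
| |- measurable_fun _ (fun _ => fst _) => apply: measurable_fun_fst_comp
| |- measurable_fun _ (fun _ => snd _) => apply: measurable_fun_snd_comp
| |- measurable_fun _ (fun _ => _) => exact: measurable_cst
end.

(* The library's sigma-finite structure on [product_measure1] is shadowed by its
   subprobability structure, hence this copy. *)
Definition sfprod d1 d2 (T1 : measurableType d1) (T2 : measurableType d2) (R : realType)
    (m1 : {sigma_finite_measure set T1 -> \bar R})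
    (m2 : {sigma_finite_measure set T2 -> \bar R}) : set (T1 * T2) -> \bar R :=
  (m1 \x m2)%E.
Arguments sfprod {d1 d2 T1 T2 R} m1 m2.

Section SfprodInstances.
Context d1 d2 (T1 : measurableType d1) (T2 : measurableType d2) (R : realType).
Context (m1 : {sigma_finite_measure set T1 -> \bar R}).
Context (m2 : {sigma_finite_measure set T2 -> \bar R}).
Local Open Scope ereal_scope.

Lemma sfprodE A1 A2 : measurable A1 -> measurable A2 ->
  sfprod m1 m2 (A1 `*` A2) = m1 A1 * m2 A2.
Proof. exact: product_measure1E. Qed.

HB.instance Definition _ := Measure.copy (sfprod m1 m2) (m1 \x m2).

Let sfprod_sigma_finite : sigma_finite setT (sfprod m1 m2).
Proof.
have /sigma_finiteP[F [TF ndF Foo]] := sigma_finiteT m1.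
have /sigma_finiteP[H [TH ndH Hoo]] := sigma_finiteT m2.
exists (fun n => F n `*` H n) => [|k].
  apply/seteqP; split=> [[x y] _|//].
  have [n _ Fx] : (\bigcup_n F n) x by rewrite -TF.
  have [k _ Hy] : (\bigcup_n H n) y by rewrite -TH.
  exists (maxn n k) => //; split.
    exact: (subsetPset _ _ (ndF _ _ (leq_maxl n k))).
  exact: (subsetPset _ _ (ndH _ _ (leq_maxr n k))).
have [? ?] := Foo k; have [? ?] := Hoo k.
split; first exact: measurableX.
by rewrite sfprodE // lte_mul_pinfty // ge0_fin_numE.
Qed.

HB.instance Definition _ := Measure_isSigmaFinite.Build _ _ _ (sfprod m1 m2)
  sfprod_sigma_finite.

Lemma sfprod_unique (m : {measure set (T1 * T2) -> \bar R}) :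
    (forall A B, measurable A -> measurable B -> m (A `*` B) = m1 A * m2 B) ->
  forall X, measurable X -> sfprod m1 m2 X = m X.
Proof. exact: product_measure_unique. Qed.

End SfprodInstances.

(** * Measure-preserving maps of product spaces *)

Section Preserving.
Local Open Scope ereal_scope.
Context {R : realType}.

Definition preserving {d} {T : measurableType d} (m : set T -> \bar R) (f : T -> T) :=
  measurable_fun setT f /\ forall A, measurable A -> m (f @^-1` A) = m A.

Lemma measurable_preimage d d' (T : measurableType d) (T' : measurableType d')
    (f : T -> T') A : measurable_fun setT f -> measurable A -> measurable (f @^-1` A).
Proof. by move=> mf mA; rewrite -[X in measurable X]setTI; exact: mf. Qed.

Lemma preserving_comp d (T : measurableType d) (m : set T -> \bar R) f g :
  preserving m f -> preserving m g -> preserving m (f \o g).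
Proof.
move=> [mf hf] [mg hg]; split; first exact: measurableT_comp.
move=> A mA; rewrite comp_preimage hg ?hf //; exact: measurable_preimage.
Qed.

Lemma product_measure12 d1 d2 (T1 : measurableType d1) (T2 : measurableType d2)
    (m1 : {sigma_finite_measure set T1 -> \bar R})
    (m2 : {sigma_finite_measure set T2 -> \bar R}) A : measurable A ->
  (m1 \x m2) A = (m1 \x^ m2) A.
Proof.
move=> mA; apply: product_measure_unique => // B C mB mC.
exact: product_measure2E.
Qed.

(** The product measure is the integral of the measures of the sections, and each section is moved
    by a single map preserving [m2]. *)
Lemma preserving_skewr d1 d2 (T1 : measurableType d1) (T2 : measurableType d2)
    (m1 : {sigma_finite_measure set T1 -> \bar R})
    (m2 : {sigma_finite_measure set T2 -> \bar R}) (phi : T1 -> T2 -> T2) :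
  measurable_fun setT (fun p : T1 * T2 => phi p.1 p.2) ->
  (forall x A, measurable A -> m2 (phi x @^-1` A) = m2 A) ->
  preserving (sfprod m1 m2) (fun p => (p.1, phi p.1 p.2)).
Proof.
move=> mphi hphi; split; first exact: measurable_fun_pair.
move=> A mA; rewrite /sfprod /product_measure1; apply: eq_integral => x _ /=.
transitivity (m2 (phi x @^-1` xsection A x)); last first.
  by rewrite hphi //; exact: measurable_xsection.
by congr (m2 _); apply/seteqP; split => y; rewrite /xsection /= !inE.
Qed.

Lemma preserving_skewl d1 d2 (T1 : measurableType d1) (T2 : measurableType d2)
    (m1 : {sigma_finite_measure set T1 -> \bar R})
    (m2 : {sigma_finite_measure set T2 -> \bar R}) (phi : T2 -> T1 -> T1) :
  measurable_fun setT (fun p : T1 * T2 => phi p.2 p.1) ->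
  (forall x A, measurable A -> m1 (phi x @^-1` A) = m1 A) ->
  preserving (sfprod m1 m2) (fun p => (phi p.2 p.1, p.2)).
Proof.
move=> mphi hphi.
have mf : measurable_fun setT (fun p : T1 * T2 => (phi p.2 p.1, p.2)).
  exact: measurable_fun_pair.
split=> // A mA; rewrite /sfprod !product_measure12 //; last exact: measurable_preimage.
rewrite /product_measure2; apply: eq_integral => x _ /=.
transitivity (m1 (phi x @^-1` ysection A x)); last first.
  by rewrite hphi //; exact: measurable_ysection.
by congr (m1 _); apply/seteqP; split => y; rewrite /ysection /= !inE.
Qed.

Local Notation leb := (@lebesgue_measure R).

Lemma lebesgue_measure_translate (c : R) (A : set R) : measurable A ->
  leb ((fun x => (x + c)%R) @^-1` A) = leb A.
Proof.
have mf : measurable_fun setT (fun x : R => (x + c)%R) by mfun.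
move=> mA; pose f (x : measurableTypeR R) : measurableTypeR R := (x + c)%R.
rewrite -[LHS]/(pushforward leb f A).
apply/esym/lebesgue_measure_unique => //.
move=> _ [[a b] _ <-] /=; rewrite /pushforward.
have -> : (fun x => (x + c)%R) @^-1` `]a, b] = `](a - c)%R, (b - c)%R]%classic.
  by apply/seteqP; split => x /=; rewrite !in_itv /= ltrBlDr lerBrDr.
rewrite !lebesgue_measure_itv /= !lte_fin ltrD2r; case: ifP => // _.
by rewrite -!EFinB; congr (_%:E); ring.
Qed.

Lemma lebesgue_measure_scale (t : R) (A : set R) : (0 < t)%R -> measurable A ->
  leb ((fun x => (x / t)%R) @^-1` A) = t%:E * leb A.
Proof.
move=> t0 mA; have mf : measurable_fun setT (fun x : R => (x / t)%R) by mfun.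
have tV : (0 <= t^-1)%R by rewrite invr_ge0 ltW.
suff -> : leb A = (t^-1)%:E * leb ((fun x => (x / t)%R) @^-1` A).
  by rewrite muleA -EFinM mulfV ?gt_eqF // mul1e.
pose f (x : measurableTypeR R) : measurableTypeR R := (x / t)%R.
pose m := mscale (NngNum tV) (pushforward leb f).
rewrite -[RHS]/(m mf A); apply: lebesgue_measure_unique => //.
move=> _ [[a b] _ <-] /=; rewrite /m /mscale /pushforward.
transitivity ((t^-1)%:E * leb `](a * t)%R, (b * t)%R]%classic); last first.
  congr (_ * leb _); apply/seteqP; split => x /=; rewrite /f !in_itv /=.
    by rewrite ltr_pdivlMr // ler_pdivrMr.
  by rewrite ltr_pdivlMr // ler_pdivrMr.
rewrite !lebesgue_measure_itv /= !lte_fin ltr_pM2r //; case: ifP => _; last by rewrite mule0.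
by rewrite -!EFinB -EFinM; congr (_%:E); field; rewrite gt_eqF.
Qed.

End Preserving.

(** * Lebesgue measure of 2x2 matrices under [SL(2,R)] *)

Section LinearActions.
Context {R : realType}.
Local Notation leb := (@lebesgue_measure R).
Local Notation leb2 := (sfprod leb leb).
Local Notation leb3 := (sfprod leb2 leb).
Local Notation leb4 := (sfprod leb2 leb2).
Local Notation mx := (mx2 R).
Local Notation V2 := (measurableTypeR R * measurableTypeR R)%type.
Implicit Types (g k : M2 R) (v w : (R * R) * (R * R)).

Definition rowmul g (p : R * R) : R * R :=
  (p.1 * g ix0 ix0 + p.2 * g ix1 ix0, p.1 * g ix0 ix1 + p.2 * g ix1 ix1).

Definition rmul4 g v := (rowmul g v.1, rowmul g v.2).

Definition lmul4 g v : (R * R) * (R * R) :=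
  ((g ix0 ix0 * v.1.1 + g ix0 ix1 * v.2.1, g ix0 ix0 * v.1.2 + g ix0 ix1 * v.2.2),
   (g ix1 ix0 * v.1.1 + g ix1 ix1 * v.2.1, g ix1 ix0 * v.1.2 + g ix1 ix1 * v.2.2)).

Lemma ofR4_rmul4 g v : ofR4 R (rmul4 g v) = ofR4 R v * g.
Proof. by apply: mx2_eq; rewrite mx2M_entries !mx2E. Qed.

(** A shear translates one coordinate by an amount depending on the other, so it is a skew product
    of translations. *)
Lemma leb2_rowmul g : \det g = 1 -> preserving leb2 (rowmul g).
Proof.
move: g; apply: SL2_ind.
- move=> x; have := @preserving_skewr R _ _ _ _ leb leb (fun a b => b + a * x).
  have -> : (fun p : R * R => (p.1, p.2 + p.1 * x)) = rowmul (mx 1 x 0 1).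
    by apply/funext => p; rewrite /rowmul !mx2E; congr (_, _); ring.
  by apply; [mfun|move=> y A mA; exact: lebesgue_measure_translate].
- move=> x; have := @preserving_skewl R _ _ _ _ leb leb (fun b a => a + b * x).
  have -> : (fun p : R * R => (p.1 + p.2 * x, p.2)) = rowmul (mx 1 0 x 1).
    by apply/funext => p; rewrite /rowmul !mx2E; congr (_, _); ring.
  by apply; [mfun|move=> y A mA; exact: lebesgue_measure_translate].
- move=> g k Pg Pk; have -> : rowmul (g * k) = rowmul k \o rowmul g.
    by apply/funext => p; rewrite /rowmul /= !mx2M_entries; congr (_, _); ring.
  exact: preserving_comp.
Qed.

Lemma leb2_translate (c : R * R) (A : set (R * R)) : measurable A ->
  leb2 ((fun p : R * R => (p.1 + c.1, p.2 + c.2)) @^-1` A) = leb2 A.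
Proof.
move=> mA.
have m1 : measurable_fun setT (fun p : R * R => p.2 + c.2) by mfun.
have m2 : measurable_fun setT (fun p : R * R => p.1 + c.1) by mfun.
have [_ h1] := @preserving_skewr R _ _ _ _ leb leb (fun _ b => b + c.2)
  m1 (fun _ => lebesgue_measure_translate c.2).
have [mf h2] := @preserving_skewl R _ _ _ _ leb leb (fun _ a => a + c.1)
  m2 (fun _ => lebesgue_measure_translate c.1).
rewrite -[RHS]h2 // -[RHS]h1 //; exact: measurable_preimage.
Qed.

Lemma leb4_rmul4 g : \det g = 1 -> preserving leb4 (rmul4 g).
Proof.
move=> /leb2_rowmul [mg hg].
have m1 : measurable_fun setT (fun v : (R * R) * (R * R) => rowmul g v.1).
  exact: measurableT_comp.
have m2 : measurable_fun setT (fun v : (R * R) * (R * R) => rowmul g v.2).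
  exact: measurableT_comp.
have P1 := @preserving_skewr R _ _ V2 V2 leb2 leb2 (fun _ b => rowmul g b) m2 (fun _ => hg).
have P2 := @preserving_skewl R _ _ V2 V2 leb2 leb2 (fun _ b => rowmul g b) m1 (fun _ => hg).
exact: (preserving_comp _ _ _ _ _ P1 P2).
Qed.

(** A shear on the left adds a multiple of one row to the other, which for a fixed first row or
    second row is a translation of the plane. *)
Lemma leb4_lmul4 g : \det g = 1 -> preserving leb4 (lmul4 g).
Proof.
move: g; apply: SL2_ind.
- move=> x; have := @preserving_skewl R _ _ V2 V2 leb2 leb2
    (fun b a => (a.1 + x * b.1, a.2 + x * b.2)).
  set f := (X in preserving _ X); have -> : f = lmul4 (mx 1 x 0 1).
    by apply/funext => v; rewrite /f /lmul4 !mx2E; case: v => -[? ?] [? ?] /=;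
      congr (_, _, (_, _)); ring.
  apply; first by mfun.
  by move=> y A mA; exact: (leb2_translate (x * y.1, x * y.2)).
- move=> x; have := @preserving_skewr R _ _ V2 V2 leb2 leb2
    (fun a b => (b.1 + x * a.1, b.2 + x * a.2)).
  set f := (X in preserving _ X); have -> : f = lmul4 (mx 1 0 x 1).
    by apply/funext => v; rewrite /f /lmul4 !mx2E; case: v => -[? ?] [? ?] /=;
      congr (_, _, (_, _)); ring.
  apply; first by mfun.
  by move=> y A mA; exact: (leb2_translate (x * y.1, x * y.2)).
- move=> g k Pg Pk; have -> : lmul4 (g * k) = lmul4 g \o lmul4 k.
    by apply/funext => p; rewrite /lmul4 /= !mx2M_entries; congr (_, _, (_, _)); ring.
  exact: preserving_comp.
Qed.

Lemma leb3_scale (t : R) (C : set ((R * R) * R)) : 0 < t -> measurable C ->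
  leb3 ((fun p : (R * R) * R => ((p.1.1 / t, p.1.2 / t), - p.2)) @^-1` C) =
  ((t ^+ 2)%:E * leb3 C)%E.
Proof.
move=> t0 mC; have tV : 0 <= (t ^+ 2)^-1 by rewrite invr_ge0 exprn_ge0 // ltW.
have t2 : t ^+ 2 != 0 by rewrite expf_eq0 gt_eqF.
have tVE : (t^-1 * t^-1)%:E = ((t ^+ 2)^-1)%:E by rewrite -invfM -expr2.
have K (x : \bar R) : (t^-1%:E * (t%:E * x) = x)%E.
  by rewrite muleA -EFinM mulVf ?gt_eqF // mul1e.
pose f1 (x : V2) : V2 := (x.1 / t, x.2 / t).
have mf1 : measurable_fun setT f1 by rewrite /f1; mfun.
have scale2 (A : set V2) : measurable A -> leb2 A = ((t ^+ 2)^-1%:E * leb2 (f1 @^-1` A))%E.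
  move=> mA; pose m := mscale (NngNum tV) (pushforward leb2 f1).
  rewrite -[RHS]/(m mf1 A); apply: sfprod_unique => // B D mB mD.
  transitivity ((t ^+ 2)^-1%:E * leb2 (((fun x => x / t)%R @^-1` B) `*`
    ((fun x => x / t)%R @^-1` D)))%E; first by [].
  have md : measurable_fun setT (fun x : R => x / t) by mfun.
  rewrite sfprodE; try exact: measurable_preimage.
  transitivity ((t ^+ 2)^-1%:E * ((t%:E * leb B) * (t%:E * leb D)))%E.
    by congr (_ * (_ * _))%E; exact: lebesgue_measure_scale.
  by rewrite -tVE EFinM muleACA !K.
pose f2 (x : V2 * measurableTypeR R) : V2 * measurableTypeR R := (f1 x.1, - x.2).
have mf2 : measurable_fun setT f2.
  by apply: measurable_fun_pair; [exact: measurableT_comp|mfun].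
suff -> : leb3 C = ((t ^+ 2)^-1%:E * leb3 (f2 @^-1` C))%E.
  by rewrite muleA -EFinM mulfV // mul1e.
pose m := mscale (NngNum tV) (pushforward leb3 f2).
rewrite -[RHS]/(m mf2 C); apply: sfprod_unique => // B D mB mD.
transitivity ((t ^+ 2)^-1%:E * leb3 ((f1 @^-1` B) `*` (-%R @^-1` D)))%E; first by [].
have mo : measurable_fun setT (fun x : R => - x) by mfun.
rewrite sfprodE; try exact: measurable_preimage.
by rewrite muleA -scale2 //; congr (_ * _)%E; exact: lebesgue_measureN.
Qed.

End LinearActions.

Lemma measurable_between d (T : measurableType d) {R : realType} (f : T -> R) (a b : R) :
  measurable_fun setT f -> measurable [set x | a < f x <= b].
Proof.
move=> mf; have -> : [set x | a < f x <= b] = f @^-1` `]a, b].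
  by apply/seteqP; split => x /=; rewrite in_itv.
exact: measurable_preimage.
Qed.

(** * Lebesgue measure of cones in the coordinates [h_s g_(a,b)] *)

Section Cone.
Context {R : realType}.
Local Notation leb := (@lebesgue_measure R).
Local Notation leb2 := (sfprod leb leb).
Local Notation leb3 := (sfprod leb2 leb).
Local Notation leb4 := (sfprod leb2 leb2).
Local Notation V2 := (measurableTypeR R * measurableTypeR R)%type.
Implicit Types (v w : (R * R) * (R * R)).

Definition det4 v : R := v.1.1 * v.2.2 - v.1.2 * v.2.1.

(** The coordinates [((a, b), s)] of [v / sqrt (det v)] from [hg_decomposition]; the slope of the
    first column is unaffected by the scaling. *)
Definition coord4 v : (R * R) * R :=
  ((v.1.1 / Num.sqrt (det4 v), v.1.2 / Num.sqrt (det4 v)), - (v.2.1 / v.1.1)).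

(* Lebesgue measure of these cones is a bi-invariant measure on SL(2,R); the bound
   [1 < det <= 2] keeps it finite on bounded sets. *)
Definition cone (C : set ((R * R) * R)) : set ((R * R) * (R * R)) :=
  [set v | 1 < det4 v <= 2 /\ C (coord4 v)].

Lemma measurable_det4 : measurable_fun setT det4.
Proof. by rewrite /det4; mfun. Qed.

Lemma measurable_coord4 : measurable_fun setT coord4.
Proof. by rewrite /coord4 /det4; mfun. Qed.

Lemma measurable_cone C : measurable C -> measurable (cone C).
Proof.
move=> mC; apply: (@measurableI _ _ [set v | 1 < det4 v <= 2] (coord4 @^-1` C)).
  exact: measurable_between _ _ _ _ _ measurable_det4.
exact: measurable_preimage measurable_coord4 mC.
Qed.

(** The cone in new coordinates: [z.1] is the first row, [z.2.1] the slope of the first column and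
    [z.2.2] the determinant. In [slab'] the slope comes last, so that it is integrated first. *)
Let slab (C : set ((R * R) * R)) : set (V2 * V2) :=
  [set z | 1 < z.2.2 <= 2 /\
     C ((z.1.1 / Num.sqrt z.2.2, z.1.2 / Num.sqrt z.2.2), - z.2.1)].

Let slab' (C : set ((R * R) * R)) : set ((V2 * measurableTypeR R) * measurableTypeR R) :=
  [set z | 1 < z.1.2 <= 2 /\
     C ((z.1.1.1 / Num.sqrt z.1.2, z.1.1.2 / Num.sqrt z.1.2), - z.2)].

Let mslab C : measurable C -> measurable (slab C).
Proof.
pose f (z : V2 * V2) : (R * R) * R :=
  ((z.1.1 / Num.sqrt z.2.2, z.1.2 / Num.sqrt z.2.2), - z.2.1).
have mf : measurable_fun setT f by rewrite /f; mfun.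
move=> mC; apply: (@measurableI _ (V2 * V2)%type [set z : V2 * V2 | 1 < z.2.2 <= 2] (f @^-1` C)).
  by apply: (measurable_between _ _ (fun z : V2 * V2 => z.2.2)); mfun.
exact: measurable_preimage mf mC.
Qed.

Let mslab' C : measurable C -> measurable (slab' C).
Proof.
pose f (z : (V2 * measurableTypeR R) * measurableTypeR R) : (R * R) * R :=
  ((z.1.1.1 / Num.sqrt z.1.2, z.1.1.2 / Num.sqrt z.1.2), - z.2).
have mf : measurable_fun setT f by rewrite /f; mfun.
move=> mC; apply: (@measurableI _ (V2 * measurableTypeR R * measurableTypeR R)%type
    [set z : V2 * measurableTypeR R * measurableTypeR R | 1 < z.1.2 <= 2] (f @^-1` C)).
  apply: (measurable_between _ _
    (fun z : (V2 * measurableTypeR R) * measurableTypeR R => z.1.2)); mfun.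
exact: measurable_preimage mf mC.
Qed.

(** For a fixed first row [(a, b)] with [a != 0], the second row is [(p, D) g_(a,b)] with [p] the
    slope and [D] the determinant, and this change of variables preserves area. Rows with [a = 0]
    have empty sections. *)
Let leb4_slab (C : set ((R * R) * R)) : measurable C -> (forall p, C p -> 0 < p.1.1) ->
  leb4 (cone C) = leb4 (slab C).
Proof.
move=> mC C0; rewrite /sfprod /product_measure1; apply: eq_integral => -[a b] _ /=.
have [a0|a0] := eqVneq a 0.
  have e (A : set (V2 * V2)) : (forall y, ~ A ((a, b), y)) -> xsection A (a, b) = set0.
    by move=> h; apply/seteqP; split => // y; rewrite /xsection /= inE => /h.
  rewrite !e //.
    by move=> y [_ /C0] /=; rewrite a0 mul0r ltxx.
  by move=> y [_ /C0] /=; rewrite a0 mul0r ltxx.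
have dg : \det (gmat R (a, b)) = 1 by rewrite det_gmat.
have [_ h] := leb2_rowmul _ dg.
transitivity (leb2 (rowmul (gmat R (a, b)) @^-1` xsection (cone C) (a, b))).
  by apply/esym/h/measurable_xsection; exact: measurable_cone.
congr (leb2 _); apply/seteqP.
have e (p : R * R) : coord4 ((a, b), rowmul (gmat R (a, b)) p) =
    ((a / Num.sqrt p.2, b / Num.sqrt p.2), - p.1) /\
    det4 ((a, b), rowmul (gmat R (a, b)) p) = p.2.
  have d4 : det4 ((a, b), rowmul (gmat R (a, b)) p) = p.2.
    by rewrite /det4 /rowmul !mx2E /=; field.
  split=> //; rewrite /coord4 d4 /=; congr (_, _, _).
  by rewrite /rowmul !mx2E /=; field.
split => p; rewrite /xsection /= !inE /cone /slab /=.
  by have [-> ->] := e p.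
by have [-> ->] := e p.
Qed.

Lemma leb4_cone : exists2 c0 : R, 0 < c0 & forall C : set ((R * R) * R),
  measurable C -> (forall p, C p -> 0 < p.1.1) -> (leb4 (cone C) = c0%:E * leb3 C)%E.
Proof.
pose w (D : R) : \bar R := if (1 < D <= 2) then D%:E else 0%E.
have mw : measurable_fun setT w.
  have mb : measurable_fun setT (fun D : R => 1 < D <= 2).
    apply: (measurable_fun_bool true); rewrite setTI.
    exact: (measurable_between _ _ (fun x : R => x)).
  apply: (measurable_fun_ifT mb) => //.
have w0 D : (0 <= w D)%E.
  by rewrite /w; case: ifP => // /andP[h _]; rewrite lee_fin; lra.
(* The constant is the integral of [D] over [(1, 2]]; bounds by 1 and 2 suffice for it to be
   positive and finite. *)
pose c := (\int[leb]_D w D)%E.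
have i12 : (\int[leb]_D (\1_(`]1, 2]%classic : set R) D)%:E = 1)%E.
  rewrite integral_indic // setIT; transitivity (leb `]1, 2]%classic) => //.
  rewrite lebesgue_measure_itv /= lte_fin ltr1n.
  by rewrite -EFinB; congr (_%:E); ring.
have cge : (1 <= c)%E.
  rewrite -i12; apply: ge0_le_integral => //.
  - by apply/measurable_EFinP; exact: measurable_indic.
  - move=> x _; rewrite /w indicE mem_setE in_itv /=; case: ifP => // /andP[h _].
    by rewrite lee_fin; exact: ltW.
have cle : (c <= 2%:E)%E.
  have e : 2%:E = (\int[leb]_D (2%:E * (\1_(`]1, 2]%classic : set R) D)%:E))%E.
    rewrite ge0_integralZl //.
    - by rewrite i12 mule1.
    - by apply/measurable_EFinP; exact: measurable_indic.
  rewrite e; apply: ge0_le_integral => //.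
  - by apply/measurable_EFinP; apply: measurable_funM => //; exact: measurable_indic.
  - move=> x _; rewrite /w indicE mem_setE in_itv /=; case: ifP => [/andP[_ h]|_].
      by rewrite mule1 lee_fin.
    by rewrite mule0.
have cfin : c \is a fin_num.
  by rewrite ge0_fin_numE ?integral_ge0 // (le_lt_trans cle) // ltry.
exists (fine c).
  by rewrite -lte_fin fineK // (lt_le_trans _ cge).
move=> C mC C0; rewrite fineK // leb4_slab //.
pose F (z : V2 * measurableTypeR R) := leb (xsection (slab' C) z).
have mF : measurable_fun setT F.
  by apply: measurable_fun_xsection; exact: mslab'.
(* Tonelli makes [D] the outermost variable. The slice at fixed [D] is [C] with its first two
   coordinates scaled by [sqrt D] and the third reflected, hence of measure [D * leb3 C]. *)
transitivity (\int[leb2]_p \int[leb]_D F (p, D))%E.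
  rewrite {1}/sfprod /product_measure1; apply: eq_integral => p _ /=.
  transitivity ((leb \x^ leb)%E (xsection (slab C) p)).
    by apply: product_measure12; apply: measurable_xsection; exact: mslab.
  rewrite /product_measure2; apply: eq_integral => D _ /=.
  congr (leb _); apply/seteqP; split => s; rewrite /xsection /ysection /= !inE /=;
    by rewrite inE.
rewrite (fubini_tonelli F) //.
transitivity (\int[leb]_D (w D * leb3 C))%E; last by rewrite ge0_integralZr.
apply: eq_integral => D _; rewrite /w; case: ifP => D12; last first.
  rewrite mul0e; apply: integral0_eq => p _; rewrite /F.
  rewrite (_ : xsection _ _ = set0) ?measure0 //; apply/seteqP; split => // s.
  by rewrite /xsection /= inE => -[] /=; rewrite D12.
have D0 : 0 < D by case/andP: D12 => h _; lra.
have sD0 : 0 < Num.sqrt D by rewrite sqrtr_gt0.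
rewrite -{2}(sqr_sqrtr (ltW D0)) -leb3_scale // /sfprod /product_measure1.
apply: eq_integral => p _; rewrite /F /=; congr (leb _).
apply/seteqP; split => s; rewrite /xsection /= !inE /slab' /=.
  by case.
by [].
Qed.

End Cone.

(** * The Borel structure of X_q *)

Section NormalizedMatrix.
Context {R : realType}.
Local Notation h := (hmat R).
Local Notation gm := (gmat R).
Implicit Types (v w : (R * R) * (R * R)) (y : (R * R) * R) (g : M2 R).

Definition hgmat y : M2 R := h y.2 * gm y.1.

Definition nmat v : M2 R := (Num.sqrt (det4 v))^-1 *: ofR4 R v.

Lemma det_ofR4 v : \det (ofR4 R v) = det4 v.
Proof. by rewrite det_mx2. Qed.

Lemma det4_rmul4 g v : \det g = 1 -> det4 (rmul4 g v) = det4 v.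
Proof. by move=> dg; rewrite -!det_ofR4 ofR4_rmul4 detM dg mulr1. Qed.

Lemma nmat_rmul4 g v : \det g = 1 -> nmat (rmul4 g v) = nmat v * g.
Proof. by move=> dg; rewrite /nmat det4_rmul4 // ofR4_rmul4 scalerAl. Qed.

Lemma nmat_det1 v : det4 v = 1 -> nmat v = ofR4 R v.
Proof. by move=> dv; rewrite /nmat dv sqrtr1 invr1 scale1r. Qed.

Lemma det_nmat v : 0 < det4 v -> \det (nmat v) = 1.
Proof.
move=> d0; have s0 : Num.sqrt (det4 v) != 0 by rewrite gt_eqF // sqrtr_gt0.
rewrite /nmat detZ det_ofR4 exprVn sqr_sqrtr ?ltW // mulVf //.
by rewrite gt_eqF.
Qed.

Lemma det_hgmat y : y.1.1 != 0 -> \det (hgmat y) = 1.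
Proof. by move=> y0; rewrite /hgmat detM det_hmat det_gmat ?mulr1. Qed.

Lemma coord4_nmat v y : 0 < det4 v -> y.1.1 != 0 ->
  coord4 v = y <-> nmat v = hgmat y.
Proof.
move=> d0 y0; have s0 : Num.sqrt (det4 v) != 0 by rewrite gt_eqF // sqrtr_gt0.
have n00 : nmat v ix0 ix0 = v.1.1 / Num.sqrt (det4 v) by rewrite /nmat mxE mx2E mulrC.
have n01 : nmat v ix0 ix1 = v.1.2 / Num.sqrt (det4 v) by rewrite /nmat mxE mx2E mulrC.
have n10 : nmat v ix1 ix0 = v.2.1 / Num.sqrt (det4 v) by rewrite /nmat mxE mx2E mulrC.
split=> [e|e].
  have a0 : v.1.1 != 0.
    by apply: contraNneq y0 => v0; rewrite -e /= v0 mul0r.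
  rewrite (hg_decomposition _ (det_nmat _ d0)) ?n00 ?n01 ?n10; last first.
    by rewrite mulf_neq0 // invr_neq0.
  rewrite /hgmat -e /=; congr (h _ * gm _).
  by field; rewrite a0 s0.
move: e; rewrite /hgmat hg_mx2 => e.
move: n00 n01 n10; rewrite e !mx2E => n00 n01 n10.
have a0 : v.1.1 != 0 by apply: contraNneq y0 => v0; rewrite n00 v0 mul0r.
rewrite /coord4 -n00 -n01.
have -> : - (v.2.1 / v.1.1) = y.2.
  have -> : v.2.1 / v.1.1 = (v.2.1 / Num.sqrt (det4 v)) / (v.1.1 / Num.sqrt (det4 v)).
    by field; rewrite a0 s0.
  by rewrite -n00 -n10; field.
by case: (y) => [[? ?] ?].
Qed.

Lemma coneP (C : set ((R * R) * R)) v : (forall p, C p -> p.1.1 != 0) ->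
  cone C v <-> 1 < det4 v <= 2 /\ exists2 y, C y & nmat v = hgmat y.
Proof.
move=> C0; split=> -[d12 Cv]; split => //.
  exists (coord4 v) => //; apply/coord4_nmat => //; last exact: C0.
  by case/andP: d12 => ? _; lra.
case: Cv => y Cy e; suff -> : coord4 v = y by [].
apply/coord4_nmat => //; last exact: C0.
by case/andP: d12 => ? _; lra.
Qed.

End NormalizedMatrix.

Section MeasurableQuotient.
Context {R : realType}.
Variables (q : nat) (hq : (3 <= q)%N).
Local Notation mx := (mx2 R).
Local Notation G := (Gq R q).
Local Notation S := (Smat R).
Local Notation T := (Tmat R q).
Local Notation h := (hmat R).
Local Notation gm := (gmat R).
Implicit Types (g k : M2 R) (y : (R * R) * R).
Local Notation X := (XqM R q).

(** Countability of [G_q], through words in [S], [T] and their inverses; it turns conditions over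
    the group into countable unions of Borel sets. *)
Lemma Gq_enum : exists e : nat -> M2 R,
  (forall n, G (e n)) /\ (forall g, G g -> exists n, e n = g).
Proof.
pose letter n : M2 R := nth 1 [:: S; T; S^-1; T^-1] n.
pose ev (w : seq nat) : M2 R := \prod_(n <- w) letter n.
have Gl n : G (letter n).
  rewrite /letter; case: n => [|[|[|[|n]]]] /=.
  - exact: Gq_S.
  - exact: Gq_T.
  - exact/Gq_inv/Gq_S.
  - exact/Gq_inv/Gq_T.
  - by rewrite nth_nil; exact: Gq_one.
have Gev w : G (ev w).
  elim: w => [|n w IH]; first by rewrite /ev big_nil; exact: Gq_one.
  by rewrite /ev big_cons; exact: Gq_mul.
have ev1 n : ev [:: n] = letter n by rewrite /ev big_seq1.
have evG g : G g -> (exists w, ev w = g) /\ (exists w, ev w = g^-1).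
  elim=> {g}.
  - by rewrite invr1; split; exists [::]; rewrite /ev big_nil.
  - by split; [exists [:: 0%N]|exists [:: 2%N]]; rewrite ev1.
  - by split; [exists [:: 1%N]|exists [:: 3%N]]; rewrite ev1.
  - move=> g k Gg [[w <-] [w' w'E]] Gk [[z <-] [z' z'E]]; split.
      by exists (w ++ z); rewrite /ev big_cat.
    exists (z' ++ w'); rewrite /ev big_cat -/(ev z') -/(ev w') w'E z'E invrM //;
      by apply/det1_unit/(det_Gq _ hq)/Gev.
  - by move=> g _ [? ?]; rewrite invrK.
exists (fun n => if unpickle n is Some w then ev w else 1); split.
  by move=> n; case: unpickle => // *; exact: Gq_one.
by move=> g /evG [[w <-] _]; exists (pickle w); rewrite pickleK.
Qed.

Lemma preXP (A : set (Xq R q)) g :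
  preX R q A g <-> \det g = 1 /\ A (toX R q (coset R q g)).
Proof.
split=> -[dg].
  move=> [x Ax e]; split => //; suff -> : toX R q (coset R q g) = x by [].
  have [k dk xE] := Xq_repr q x; move: e; rewrite xE sval_toX // => -> //.
by move=> Ag; split => //; exists (toX R q (coset R q g)) => //; rewrite sval_toX.
Qed.

Lemma measurable_det1 : measurable [set v : (R * R) * (R * R) | det4 v = 1].
Proof.
apply: (measurable_preimage _ _ _ _ det4 [set 1]) => //; exact: measurable_det4.
Qed.

(** [Xq_borel] is already a sigma-algebra, so generating one from it adds no sets. *)
Lemma measurable_XqM (A : set X) :
  measurable A <-> measurable (ofR4 R @^-1` preX R q A).
Proof.
suff sA : sigma_algebra setT (Xq_borel R q).
  by rewrite -[measurable A]/(<<s Xq_borel R q >> A) sigma_algebra_id.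
have preE (B : set (Xq R q)) : ofR4 R @^-1` preX R q B =
    [set v | det4 v = 1] `&` [set v | B (toX R q (coset R q (ofR4 R v)))].
  by apply/seteqP; split => v /=; rewrite preXP det_ofR4.
rewrite /Xq_borel; split => /=.
- suff -> : ofR4 R @^-1` preX R q set0 = set0 by [].
  by apply/seteqP; split => v //= /preXP [].
- move=> B mB; suff -> : ofR4 R @^-1` preX R q (setT `\` B) =
      [set v | det4 v = 1] `\` (ofR4 R @^-1` preX R q B).
    by apply: measurableD => //; exact: measurable_det1.
  rewrite !preE; apply/seteqP; split => v /=.
    by move=> [dv [_ nB]]; split => // -[].
  by move=> [dv nB]; split => //; split => // Bv; apply: nB.
- move=> F mF; suff -> : ofR4 R @^-1` preX R q (\bigcup_k F k) =
      \bigcup_k (ofR4 R @^-1` preX R q (F k)) by exact: bigcup_measurable.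
  apply/seteqP; split => v.
    by rewrite preE => -[/= dv [n _ Fn]]; exists n => //; rewrite preE.
  by move=> [n _]; rewrite !preE => -[/= dv Fn]; split => //; exists n.
Qed.

Lemma measurable_hgmat_entries : exists f : (R * R) * R -> (R * R) * (R * R),
  measurable_fun setT f /\ forall y, ofR4 R (f y) = hgmat y.
Proof.
exists (fun y => ((y.1.1, y.1.2), (- (y.2 * y.1.1), y.1.1^-1 - y.2 * y.1.2))).
by split; [mfun|move=> y; rewrite /hgmat hg_mx2].
Qed.

Lemma measurable_Phiq_preimage (A : set X) : measurable A ->
  measurable (Phiq R q @^-1` A `&` [set y | y.1.1 != 0]).
Proof.
move=> /measurable_XqM mA; have [f [mf fE]] := measurable_hgmat_entries.
suff -> : Phiq R q @^-1` A `&` [set y | y.1.1 != 0] =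
    f @^-1` (ofR4 R @^-1` preX R q A) `&` [set y | y.1.1 != 0].
  apply: measurableI; first exact: measurable_preimage.
  have -> : [set y : (R * R) * R | y.1.1 != 0] = (fun y => y.1.1) @^-1` ~` [set 0].
    by apply/seteqP; split => y /= /eqP.
  by apply: measurable_preimage; first [by mfun|exact: measurableC].
apply/seteqP; split => y [/= Ay y0]; split => //=; move: Ay; rewrite preXP fE.
  by move=> Ay; split => //; exact: det_hgmat.
by case.
Qed.

(** The preimage of the image in [SL(2,R)] is the countable union, over the group, of right
    translates of the Borel set where the coordinates lie in [B]. *)
Lemma measurable_Phiq_image (B : set ((R * R) * R)) : measurable B ->
  (forall y, B y -> y.1.1 != 0) -> measurable (Phiq R q @` B : set X).
Proof.
move=> mB B0; apply/measurable_XqM; have [e [Ge eG]] := Gq_enum.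
suff -> : ofR4 R @^-1` preX R q (Phiq R q @` B) =
    [set v | det4 v = 1] `&` \bigcup_n (rmul4 (e n) @^-1` (coord4 @^-1` B)).
  apply: measurableI; first exact: measurable_det1.
  apply: bigcupT_measurable => n.
  have [mr _] := leb4_rmul4 _ (det_Gq _ hq _ (Ge n)).
  apply: (measurable_preimage _ _ _ _ _ _ mr).
  exact: (measurable_preimage _ _ _ _ _ _ measurable_coord4).
have P v n y : det4 v = 1 -> B y ->
    coord4 (rmul4 (e n) v) = y <-> ofR4 R v * e n = hgmat y.
  move=> dv By; have de := det_Gq _ hq _ (Ge n).
  have dr : det4 (rmul4 (e n) v) = 1 by rewrite det4_rmul4.
  rewrite coord4_nmat ?dr ?ltr01 //; last exact: B0.
  by rewrite nmat_det1 // ofR4_rmul4.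
apply/seteqP; split => v.
  move/preXP; rewrite det_ofR4 => -[dv [y By ey]]; split => //.
  have /(coset_eqP _ hq) [k Gk kE] : coset R q (ofR4 R v) = coset R q (hgmat y).
    by apply/esym/(toX_inj _ _ _ _ _ ey); rewrite ?det_ofR4 //; exact/det_hgmat/B0.
  have [n nE] := eG _ Gk; exists n => //=.
  by rewrite ((P v n y dv By).2 _) // nE.
move=> [dv [n _ /= Bn]]; apply/preXP; rewrite det_ofR4; split => //.
exists (coord4 (rmul4 (e n) v)) => //.
rewrite /Phiq -/(hgmat _) -((P v n _ dv Bn).1 erefl); congr toX.
exact: coset_mulG.
Qed.

Lemma measurable_Tq : measurable (Tq R q).
Proof.
apply: (@measurableI _ _ [set ab : R * R | 0 < ab.1 <= 1]
   [set ab : R * R | 1 - lambdaq R q * ab.1 < ab.2 <= 1]).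
  by apply: (measurable_between _ _ (fun ab : R * R => ab.1)); mfun.
have -> : [set ab : R * R | 1 - lambdaq R q * ab.1 < ab.2 <= 1] =
  [set ab : R * R | 0 < ab.2 - (1 - lambdaq R q * ab.1) <= 1 - (1 - lambdaq R q * ab.1)].
  by apply/seteqP; split => ab /=; rewrite subr_gt0 lerD2r.
have -> : [set ab : R * R | 0 < ab.2 - (1 - lambdaq R q * ab.1) <=
    1 - (1 - lambdaq R q * ab.1)] =
  (fun ab => ab.2 - (1 - lambdaq R q * ab.1)) @^-1` `]0, +oo[ `&`
  (fun ab => ab.2) @^-1` `]-oo, 1].
  apply/seteqP; split => ab /=; rewrite !in_itv /= andbT lerD2r.
    by move=> /andP.
  by move=> [-> ->].
by apply: measurableI; apply: measurable_preimage => //; mfun.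
Qed.

Lemma Yq_gt0 y : Yq R q y -> 0 < y.1.1.
Proof. by case=> /Tq_gt0. Qed.

Lemma Yq_neq0 y : Yq R q y -> y.1.1 != 0.
Proof. by move=> /Yq_gt0 y0; rewrite gt_eqF. Qed.

(** The condition [s < Rq] says that no vector of the enumerated lattice lies in the strip with
    slope in [(0, s]]. This precedes the measurability of [Rq], which is read off from the sections
    of [Yq]. *)
Lemma measurable_Yq : measurable (Yq R q).
Proof.
have [e [Ge eG]] := Gq_enum.
(* [v1 n] and [sl n] are the first coordinate and the slope of the lattice vector
   [g_(a,b) e_n e1]. *)
pose v1 n (y : (R * R) * R) := y.1.1 * e n ix0 ix0 + y.1.2 * e n ix1 ix0.
pose sl n (y : (R * R) * R) := (y.1.1^-1 * e n ix1 ix0) / v1 n y.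
suff -> : Yq R q = (fst @^-1` Tq R q `&` snd @^-1` `[0, +oo[) `\`
    \bigcup_n ([set y | 0 < v1 n y <= 1] `&`
      (sl n @^-1` `]0, +oo[ `&` (fun y => y.2 - sl n y) @^-1` `[0, +oo[)).
  apply: measurableD.
    apply: measurableI; apply: measurable_preimage => //; exact: measurable_Tq.
  apply: bigcupT_measurable => n; apply: measurableI.
    by apply: measurable_between; rewrite /v1; mfun.
  by apply: measurableI; apply: measurable_preimage => //; rewrite /sl /v1; mfun.
have col n (ab : R * R) : mulv R (gm ab) (mulv R (e n) (1, 0)) =
    (ab.1 * e n ix0 ix0 + ab.2 * e n ix1 ix0, ab.1^-1 * e n ix1 ix0).
  by rewrite mulv_e1 mulv_mx2 /=; congr (_, _); ring.
apply/seteqP; split => y.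
  move=> [Ty /andP[y0 yR]]; split; first by split => //=; rewrite in_itv /= y0.
  move=> [n _ [/= v01]]; rewrite !in_itv /= !andbT subr_ge0 => -[s0 sy].
  have [_ /(_ (sl n y))] := Rq_min _ hq _ Ty.
  suff S1 : slopes R q y.1 (sl n y) by move=> /(_ S1); lra.
  exists (mulv R (gm y.1) (mulv R (e n) (1, 0))); rewrite ?col //=.
  split; last by split.
  by exists (mulv R (e n) (1, 0)) => //; exists (e n).
move=> [[/= Ty]]; rewrite in_itv /= andbT => y0 no; split => //.
rewrite y0 /= ltNge; apply/negP => Ry; apply: no.
have [[v [[_ [k Gk <-] <-] [v01 s0]] vE] _] := Rq_min _ hq _ Ty.
have [n nE] := eG _ Gk; move: v01 s0 vE; rewrite -nE col => /= v01 s0 vE.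
exists n => //; split => //; split; rewrite /= in_itv /= andbT //.
by rewrite subr_ge0 /sl /v1 vE.
Qed.

(** First columns of the matrices in a coset are the vectors of its lattice, so these are the
    lattices missing the strip [0 < x <= c]. *)
Definition avoiding (c : R) : set X :=
  [set x | forall k, sval x k -> ~ (0 < k ix0 ix0 <= c)].

Lemma avoidingP c g : \det g = 1 -> avoiding c (toX R q (coset R q g)) <->
  forall k, G k -> ~ (0 < (g * k) ix0 ix0 <= c).
Proof.
move=> dg; rewrite /avoiding /= sval_toX //; split => H k.
  by move=> Gk; apply: H; exists k.
by move=> [m Gm <-]; exact: H.
Qed.

Lemma slopeset_avoiding g : \det g = 1 ->
  slopeset q g !=set0 <-> ~ avoiding 1 (toX R q (coset R q g)).
Proof.
move=> dg; rewrite avoidingP //; split=> [[_ [v [/glatt_columnP [k Gk ->] v01] _]]|].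
  by move=> /(_ k Gk); apply.
move=> /existsNP [k /not_implyP [Gk /contrapT k01]].
exists ((g * k) ix1 ix0 / (g * k) ix0 ix0).
exists ((g * k) ix0 ix0, (g * k) ix1 ix0) => //; split => //.
by apply/glatt_columnP; exists k.
Qed.

Lemma Phiq_imageE : Phiq R q @` Yq R q = ~` avoiding 1.
Proof.
apply/seteqP; split => x; have [g dg ->] := Xq_repr q x.
  by move=> /(Phiq_image _ hq _ dg)/slopeset_avoiding; apply.
by move=> /slopeset_avoiding H; apply/(Phiq_image _ hq _ dg)/H.
Qed.

Lemma measurable_avoiding c : measurable (avoiding c).
Proof.
apply/measurable_XqM; have [e [Ge eG]] := Gq_enum.
suff -> : ofR4 R @^-1` preX R q (avoiding c) =
    [set v | det4 v = 1] `\` \bigcup_n [set v | 0 < (rmul4 (e n) v).1.1 <= c].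
  apply: measurableD; first exact: measurable_det1.
  apply: bigcupT_measurable => n; apply: measurable_between.
  by rewrite /rmul4 /rowmul; mfun.
have rE v n : (rmul4 (e n) v).1.1 = (ofR4 R v * e n) ix0 ix0.
  by rewrite -ofR4_rmul4 mx2E.
apply/seteqP; split => v.
  move/preXP; rewrite det_ofR4 => -[dv]; rewrite avoidingP ?det_ofR4 // => H.
  by split => // -[n _]; rewrite /mkset rE; exact: H.
move=> [dv no]; apply/preXP; rewrite det_ofR4; split => //.
rewrite avoidingP ?det_ofR4 // => k Gk k01; apply: no.
by have [n nE] := eG _ Gk; exists n => //; rewrite /mkset rE nE.
Qed.

Variable mu : probability X R.
Hypothesis hmu : SL2inv_prob R q mu.

(* diag(c, 1/c) carries the lattices avoiding the strip of width 1 to those avoiding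
   the strip of width c, and no lattice avoids all strips. *)
Lemma mu_avoiding1 : mu (avoiding 1) = 0%E.
Proof.
pose F n := avoiding n.+1%:R.
have Fmu n : mu (F n) = mu (avoiding 1).
  have n0 : n.+1%:R != 0 :> R by rewrite pnatr_eq0.
  pose d : M2 R := mx n.+1%:R 0 0 n.+1%:R^-1.
  have dd : \det d = 1 by rewrite det_mx2 mulfV //; ring.
  rewrite -(hmu d dd (avoiding 1)); last exact: measurable_avoiding.
  congr (mu _); apply/seteqP; split => x.
    have [g dg ->] := Xq_repr q x; rewrite /F avoidingP // => H.
    exists (toX R q (coset R q (d^-1 * g))).
      rewrite avoidingP ?detM ?detV1 ?mul1r // => k Gk; rewrite -mulrA => k01.
      apply: (H k Gk); move: k01.
      rewrite mx2V ?mx2M_entries -?det_mx2 // !mx2E oppr0 mul0r addr0.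
      have p : 0 < n.+1%:R :> R by rewrite ltr0n.
      by rewrite pmulr_rgt0 ?invr_gt0 // ler_pdivrMl // mulr1.
    by rewrite actX_toX ?detM ?detV1 ?mul1r // mulrA mulrV ?mul1r // det1_unit.
  move=> [x' ax' <-]; move: ax'; have [g dg ->] := Xq_repr q x'.
  rewrite avoidingP // => H; rewrite actX_toX // /F avoidingP ?detM ?dd ?mul1r //.
  move=> k Gk; rewrite -mulrA mx2M_entries !mx2E mul0r addr0 => k01.
  apply: (H k Gk); move: k01; have p : 0 < n.+1%:R :> R by rewrite ltr0n.
  by rewrite pmulr_rgt0 // -ler_pdivlMl // mulVf.
have F0 : \bigcap_n F n = set0.
  apply/seteqP; split => // x; have [g dg ->] := Xq_repr q x => H.
  have pos k : G k -> (g * k) ix0 ix0 <= 0.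
    move=> Gk; rewrite leNgt; apply/negP => k0.
    have := H (Num.truncn ((g * k) ix0 ix0)) I; rewrite /F avoidingP // => /(_ k Gk).
    by apply; rewrite k0 /= ltW // truncnS_gt.
  (* The elements [1], [S], [S^2 = -1] and [S^3] bound both entries of the top row of [g] from both
     sides by 0, against [det g = 1]. *)
  have GS := Gq_S R q.
  have p1 := pos _ (Gq_one R q).
  have p2 := pos _ GS.
  have p3 := pos _ (Gq_mul _ _ _ _ GS GS).
  have p4 := pos _ (Gq_mul _ _ _ _ GS (Gq_mul _ _ _ _ GS GS)).
  move: p1 p2 p3 p4; rewrite mulr1 !mx2M_entries !mx2E.
  move: dg; rewrite det_entries => dg p1 p2 p3 p4.
  have a0 : g ix0 ix0 = 0 by lra.
  have b0 : g ix0 ix1 = 0 by lra.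
  by move: dg; rewrite a0 b0; lra.
have mF n : measurable (F n) by exact: measurable_avoiding.
have ndF : nonincreasing_seq F.
  apply/nonincreasing_seqP => n; apply/subsetPset => x H k xk k01.
  apply: (H k xk); case/andP: k01 => -> /= k1; apply: le_trans k1 _.
  by rewrite ler_nat.
have := @nonincreasing_cvg_mu _ _ _ mu F.
rewrite F0 measure0 => /(_ _ mF _ ndF) cF.
have {}cF : mu (avoiding 1) @[n --> \oo] --> 0%E.
  have -> : (fun _ : nat => mu (avoiding 1)) = mu \o F by apply/funext => n /=; rewrite Fmu.
  by apply: cF => //; rewrite ?Fmu (le_lt_trans (probability_le1 _ _)) ?ltry.
exact: (cvg_unique _ (cvg_cst _) cF).
Qed.

Lemma mu_Phiq_image : mu (Phiq R q @` Yq R q) = 1%E.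
Proof.
rewrite Phiq_imageE probability_setC ?mu_avoiding1 ?sube0 //.
exact: measurable_avoiding.
Qed.

End MeasurableQuotient.

(** * Uniqueness of the invariant measure *)

(** Only the positive real [c] is cancelled: when this is applied, the volume of [Yq] might still be
    infinite. *)
Lemma mule_cancell {R : realType} (c : R) (a b d : \bar R) : 0 < c ->
  (c%:E * a = c%:E * b * d)%E -> (a = b * d)%E.
Proof.
move=> c0; rewrite -muleA => /(congr1 (fun t => (c^-1)%:E * t)%E).
by rewrite !(muleA c^-1%:E) -!EFinM mulVf ?gt_eqF // !mul1e.
Qed.

Section Adjugate.
Context {R : realType}.
Implicit Types (v : (R * R) * (R * R)) (g : M2 R).

(** The adjugate: it has the same determinant as [v] and normalizes to the inverse, so inversion
    becomes a linear map on [R^4]. *)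
Definition adj4 v : (R * R) * (R * R) := ((v.2.2, - v.1.2), (- v.2.1, v.1.1)).

Lemma det4_adj4 v : det4 (adj4 v) = det4 v.
Proof. by rewrite /det4 /adj4 /=; ring. Qed.

Lemma nmat_adj4 v : 0 < det4 v -> nmat (adj4 v) = (nmat v)^-1.
Proof.
move=> d0; rewrite inv_entries ?det_nmat // /nmat det4_adj4.
by apply: mx2_eq; rewrite !mxE /= ?mulrN.
Qed.

Lemma rmul4_adj4_lmul4 g v : \det g = 1 -> rmul4 g (adj4 (lmul4 g v)) = adj4 v.
Proof.
rewrite det_entries => dg.
by case: v => -[a b] [c d]; rewrite /rmul4 /rowmul /adj4 /lmul4 /=;
  congr (_, _, (_, _)); rewrite -[RHS]mul1r -dg; ring.
Qed.

Lemma measurable_adj4 : measurable_fun setT adj4.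
Proof. by rewrite /adj4; mfun. Qed.

Lemma measurable_rmul4_hgmat : measurable_fun setT
  (fun p : ((R * R) * (R * R)) * ((R * R) * R) => rmul4 (hgmat p.2) p.1).
Proof.
have -> : (fun p : ((R * R) * (R * R)) * ((R * R) * R) => rmul4 (hgmat p.2) p.1) =
  (fun p => let a := p.2.1.1 in let b := p.2.1.2 in
    let c := - (p.2.2 * p.2.1.1) in let d := p.2.1.1^-1 - p.2.2 * p.2.1.2 in
    ((p.1.1.1 * a + p.1.1.2 * c, p.1.1.1 * b + p.1.1.2 * d),
     (p.1.2.1 * a + p.1.2.2 * c, p.1.2.1 * b + p.1.2.2 * d))).
  by apply/funext => p; rewrite /rmul4 /rowmul /hgmat hg_mx2 !mx2E.
by cbv zeta; mfun.
Qed.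

End Adjugate.

Section HaarUniqueness.
Context {R : realType}.
Variables (q : nat) (hq : (3 <= q)%N).
Local Notation leb := (@lebesgue_measure R).
Local Notation leb2 := (sfprod leb leb).
Local Notation leb3 := (sfprod leb2 leb).
Local Notation leb4 := (sfprod leb2 leb2).
Local Notation V2 := (measurableTypeR R * measurableTypeR R)%type.
Local Notation V3 := (V2 * measurableTypeR R)%type.
Local Notation V4 := (V2 * V2)%type.
Local Notation X := (XqM R q).
Variable mu : probability X R.
Hypothesis hmu : SL2inv_prob R q mu.
Implicit Types (A C : set V3) (x : V4) (y z : V3) (g : M2 R).

(** The default [((0, 0), 0)] lies outside [Yq], so points off the image of [Phiq] contribute to no
    subset of [Yq]. *)
Definition Phiq_inv (x : X) : V3 := xget ((0, 0), 0) [set y | Yq R q y /\ Phiq R q y = x].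

Lemma Phiq_invK y : Yq R q y -> Phiq_inv (Phiq R q y) = y.
Proof.
move=> Yy; rewrite /Phiq_inv; case: xgetP => [z _ [Yz e]|no].
  exact: Phiq_inj e.
by case: (no y).
Qed.

Lemma Phiq_inv_preimage C : C `<=` Yq R q -> Phiq_inv @^-1` C = Phiq R q @` C.
Proof.
move=> CY; apply/seteqP; split => x /=; last first.
  by move=> [y Cy <-]; rewrite Phiq_invK //; exact: CY.
move=> Cx; have := CY _ Cx; move: Cx; rewrite /Phiq_inv.
case: xgetP => [y _ [Yy yx] Cy _|_ _ [/Tq_gt0]]; first by exists y.
by rewrite ltxx.
Qed.

Lemma measurable_Phiq_inv : measurable_fun setT Phiq_inv.
Proof.
move=> _ B mB; rewrite setTI.
have mY := @measurable_Yq R q hq.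
have mBY : measurable (Phiq_inv @^-1` (B `&` Yq R q)).
  rewrite Phiq_inv_preimage; last by move=> y [].
  apply: measurable_Phiq_image => //; first exact: measurableI.
  by move=> y [_ /Yq_neq0].
have mE : measurable (Phiq_inv @^-1` Yq R q).
  by rewrite Phiq_inv_preimage //; apply: measurable_Phiq_image => // y /Yq_neq0.
have out (x : X) : ~ Yq R q (Phiq_inv x) -> Phiq_inv x = ((0, 0), 0).
  by rewrite /Phiq_inv; case: xgetP => // y _ [Yy _].
(* The preimage of [B] contains the complement of the image of [Phiq] exactly when [B] contains the
   default point. *)
have [B0|B0] := pselect (B ((0, 0), 0)).
  suff -> : Phiq_inv @^-1` B = (Phiq_inv @^-1` (B `&` Yq R q)) `|`
      ~` (Phiq_inv @^-1` Yq R q) by apply: measurableU => //; exact: measurableC.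
  apply/seteqP; split => x /=.
    by move=> Bx; have [Yx|nYx] := pselect (Yq R q (Phiq_inv x)); [left|right].
  by move=> [[]//|/out ->].
suff -> : Phiq_inv @^-1` B = Phiq_inv @^-1` (B `&` Yq R q) by [].
apply/seteqP; split => x /=; last by case.
move=> Bx; split => //; apply: contrapT => /out e; apply: B0.
by rewrite -e.
Qed.

Lemma section_measure : exists mu' : probability V3 R,
  forall C, C `<=` Yq R q -> mu' C = mu (Phiq R q @` C).
Proof.
pose f : {mfun X >-> V3} := mfun_Sub (mem_set measurable_Phiq_inv).
exists (distribution mu f) => C CY; rewrite -Phiq_inv_preimage //.
Qed.

Lemma mu_left_translate g A C : \det g = 1 -> measurable A -> A `<=` Yq R q ->
    C `<=` Yq R q ->
  (forall y, A y -> exists2 z, C z & g * hgmat y = hgmat z) ->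
  (forall z, C z -> exists2 y, A y & g * hgmat y = hgmat z) ->
  mu (Phiq R q @` A) = mu (Phiq R q @` C).
Proof.
move=> dg mA AY CY AC CA; rewrite -(hmu g dg); last first.
  by apply: measurable_Phiq_image => // y /AY/Yq_neq0.
congr (mu _); apply/seteqP; split => x.
  move=> [_ [y Ay <-] <-]; have [z Cz e] := AC _ Ay; exists z => //.
  by rewrite /Phiq actX_toX -/(hgmat y) ?det_hgmat ?e //; exact/Yq_neq0/AY.
move=> [z Cz <-]; have [y Ay e] := CA _ Cz; exists (Phiq R q y); first by exists y.
by rewrite /Phiq actX_toX -/(hgmat y) ?det_hgmat ?e //; exact/Yq_neq0/AY.
Qed.

Variable mu' : probability V3 R.
Hypothesis mu'E : forall C, C `<=` Yq R q -> mu' C = mu (Phiq R q @` C).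

Let product_constant_sections A (k : \bar R) (W : set (V4 * V3)) : measurable A ->
    (0 <= k)%E -> measurable W ->
    (forall y, leb4 (ysection W y) = (\1_A y)%:E * k)%E ->
  ((leb4 \x mu') W = k * mu' A)%E.
Proof.
move=> mA k0 mW h.
have mi : measurable_fun setT (fun y => (\1_A y)%:E : \bar R).
  by apply/measurable_EFinP; exact: measurable_indic.
rewrite product_measure12 // /product_measure2.
transitivity (\int[mu']_y ((\1_A y)%:E * k))%E.
  by apply: eq_integral => y _; exact: h.
by rewrite ge0_integralZr // integral_indic // setIT muleC.
Qed.

(** Up to normalization [W] consists of the pairs [(x, y)] with [y] in [A] and [x y] over [C], while
    [W'] has [x^-1 y] over [C]. Computing both measures through either variable yields the
    uniqueness. *)
Let W A C : set (V4 * V3) := [set p | A p.2 /\ cone C (rmul4 (hgmat p.2) p.1)].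
Let W' A C : set (V4 * V3) := [set p | A p.2 /\ cone C (rmul4 (hgmat p.2) (adj4 p.1))].

Let mW A C : measurable A -> measurable C -> measurable (W A C).
Proof.
move=> mA mC; apply: (@measurableI _ (V4 * V3)%type (snd @^-1` A)
  ((fun p : V4 * V3 => rmul4 (hgmat p.2) p.1) @^-1` cone C)).
  exact: measurable_preimage.
apply: measurable_preimage; first exact: measurable_rmul4_hgmat.
exact: measurable_cone.
Qed.

Let mW' A C : measurable A -> measurable C -> measurable (W' A C).
Proof.
move=> mA mC.
have mf : measurable_fun setT (fun p : V4 * V3 => (adj4 p.1, p.2)).
  apply: measurable_fun_pair; last exact: measurable_snd.
  exact: (measurableT_comp measurable_adj4 measurable_fst).
exact: (measurable_preimage _ _ _ _ _ _ mf (mW _ _ mA mC)).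
Qed.

Let ysectionW A C (f : V4 * V3 -> V4) y :
  ysection [set p | A p.2 /\ cone C (f p)] y =
  [set x | A y /\ cone C (f (x, y))].
Proof. by apply/seteqP; split => x; rewrite /ysection /= inE. Qed.

(** The section at [y] in [A] is a preimage of the cone under right multiplication by [hgmat y], so
    its measure does not depend on [y]. *)
Let W_measure A C : measurable A -> measurable C -> A `<=` Yq R q ->
  ((leb4 \x mu') (W A C) = leb4 (cone C) * mu' A)%E.
Proof.
move=> mA mC AY; apply: (product_constant_sections _ _ _ mA _ (mW _ _ mA mC)) => //.
move=> y; rewrite ysectionW indicE; have [/set_mem Ay|/negP nAy] := boolP (y \in A).
  rewrite mul1e; have [_ h] := leb4_rmul4 _ (det_hgmat y (Yq_neq0 q _ (AY _ Ay))).
  rewrite -[RHS]h; last exact: measurable_cone.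
  by congr (leb4 _); apply/seteqP; split => x // [].
rewrite mul0e (_ : [set _ | _] = set0) ?measure0 //.
by apply/seteqP; split => x // -[/mem_set].
Qed.

(** Replacing [x] by [y x] preserves [leb4] and turns [x^-1 y] into [x^-1], so again the measure of
    the section does not depend on [y]. *)
Let W'_measure A C : measurable A -> measurable C -> A `<=` Yq R q ->
  ((leb4 \x mu') (W' A C) = leb4 (adj4 @^-1` cone C) * mu' A)%E.
Proof.
move=> mA mC AY; apply: (product_constant_sections _ _ _ mA _ (mW' _ _ mA mC)) => //.
move=> y; rewrite ysectionW indicE; have [/set_mem Ay|/negP nAy] := boolP (y \in A).
  have dy := det_hgmat y (Yq_neq0 q _ (AY _ Ay)).
  rewrite mul1e; have [_ h] := leb4_lmul4 _ dy.
  rewrite -[LHS]h; last first.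
    have := measurable_ysection y (mW' A C mA mC).
    by rewrite ysectionW.
  congr (leb4 _); apply/seteqP; split => x /=.
    by rewrite rmul4_adj4_lmul4 // => -[].
  by rewrite rmul4_adj4_lmul4.
rewrite mul0e (_ : [set _ | _] = set0) ?measure0 //.
by apply/seteqP; split => x // -[/mem_set].
Qed.

(** At fixed [x], left multiplication by the normalized [x] carries the section of the first set,
    the [y] in [Yq] with [x y] over [C], onto that of the second, the [z] in [C] with [x^-1 z] over
    [Yq]. Left invariance of [mu] equates their measures. *)
Let W_symmetric C : measurable C -> C `<=` Yq R q ->
  ((leb4 \x mu') (W (Yq R q) C) = (leb4 \x mu') (W' C (Yq R q)))%E.
Proof.
move=> mC CY; have mY := @measurable_Yq R q hq.
rewrite /product_measure1; apply: eq_integral => x _ /=.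
have WE : xsection (W (Yq R q) C) x =
    [set y | Yq R q y /\ cone C (rmul4 (hgmat y) x)].
  by apply/seteqP; split => y; rewrite /xsection /= inE.
have W'E : xsection (W' C (Yq R q)) x =
    [set z | C z /\ cone (Yq R q) (rmul4 (hgmat z) (adj4 x))].
  by apply/seteqP; split => y; rewrite /xsection /= inE.
have mA := measurable_xsection x (mW _ _ mY mC).
rewrite WE W'E in mA *.
have [d12|d12] := boolP (1 < det4 x <= 2); last first.
  have W0 : [set y | Yq R q y /\ cone C (rmul4 (hgmat y) x)] = set0.
    apply/seteqP; split => z // -[Yz [+ _]].
    by rewrite det4_rmul4 ?(negbTE d12) // det_hgmat // (Yq_neq0 q).
  have W'0 : [set z | C z /\ cone (Yq R q) (rmul4 (hgmat z) (adj4 x))] = set0.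
    apply/seteqP; split => z // -[Cz [+ _]].
    rewrite det4_rmul4 ?det4_adj4 ?(negbTE d12) //.
    exact/det_hgmat/(Yq_neq0 q)/CY.
  by rewrite W0 W'0.
have d0 : 0 < det4 x by case/andP: d12 => ? _; lra.
have dx := det_nmat _ d0; have ux := det1_unit _ dx.
have C0 p : C p -> p.1.1 != 0 by move=> /CY/Yq_neq0.
have coneW y : Yq R q y -> cone C (rmul4 (hgmat y) x) <->
    exists2 z, C z & nmat x * hgmat y = hgmat z.
  move=> Yy; have dy := det_hgmat y (Yq_neq0 q _ Yy).
  by rewrite (coneP _ _ C0) det4_rmul4 // nmat_rmul4 //; split => [[]|].
have coneW' z : C z -> cone (Yq R q) (rmul4 (hgmat z) (adj4 x)) <->
    exists2 y, Yq R q y & nmat x * hgmat y = hgmat z.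
  move=> Cz; have dz := det_hgmat z (C0 _ Cz).
  rewrite (coneP _ _ (@Yq_neq0 R q)) det4_rmul4 // det4_adj4 nmat_rmul4 // nmat_adj4 //.
  split=> [[_ [y Yy e]]|[y Yy e]]; [exists y => //|split=> //; exists y => //].
    by rewrite -e mulrA mulrV // mul1r.
  by rewrite -e mulrA mulVr // mul1r.
rewrite !mu'E; try by move=> z [// /CY].
apply: (mu_left_translate (nmat x)) => //.
- by move=> y [].
- by move=> z [/CY].
- move=> y [Yy /(coneW _ Yy) [z Cz e]]; exists z => //; split => //.
  by apply/(coneW' _ Cz); exists y.
- move=> z [Cz /(coneW' _ Cz) [y Yy e]]; exists y => //; split => //.
  by apply/(coneW _ Yy); exists z.
Qed.

Lemma leb3_proportional C : measurable C -> C `<=` Yq R q ->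
  (leb3 C = leb3 (Yq R q) * mu' C)%E.
Proof.
have mY := @measurable_Yq R q hq.
have mu'Y : mu' (Yq R q) = 1%E by rewrite mu'E // mu_Phiq_image.
(* The three facts on [W] and [W'] make the cone measure a fixed multiple of [mu']; taking [D = Yq]
   identifies the factor. *)
have key D : measurable D -> D `<=` Yq R q ->
    (leb4 (cone D) = leb4 (adj4 @^-1` cone (Yq R q)) * mu' D)%E.
  move=> mD DY; rewrite -W'_measure // -W_symmetric // W_measure //.
  by rewrite mu'Y mule1.
have keyY := key _ mY (@subset_refl _ _); rewrite mu'Y mule1 in keyY.
move=> mC CY; have := key _ mC CY; rewrite -keyY.
have [c0 c0_gt0 coneE] := @leb4_cone R.
have C0 (p : (R * R) * R) : C p -> 0 < p.1.1 by move=> /CY/Yq_gt0.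
rewrite (coneE C mC C0) (coneE _ mY (@Yq_gt0 R q)).
exact: mule_cancell.
Qed.

Lemma leb3_Yq : (0 < leb3 (Yq R q) < +oo)%E.
Proof.
have mY := @measurable_Yq R q hq.
pose I : set (measurableTypeR R) := `]2^-1, 1]%classic.
pose J : set (measurableTypeR R) := `[0, 1[%classic.
(* A box of volume 1/4 inside [Yq]: [1 - lam * a < 1/2 < b] since [lam >= 1], and [s < 1 <= Rq]. An
   infinite volume of [Yq] would force the volume of the box to be 0 or infinite. *)
pose B : set V3 := (I `*` I) `*` J.
have mI : measurable I by exact: measurable_itv.
have mJ : measurable J by exact: measurable_itv.
have mB : measurable B by apply: measurableX => //; exact: measurableX.
have BY : B `<=` Yq R q.
  move=> [[a b] s] [[/= + +] +]; rewrite /I /J /= !in_itv /=.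
  move=> /andP[a0 a1] /andP[b0 b1] /andP[s0 s1].
  have Tab : Tq R q (a, b).
    have l1 : 1 <= lambdaq R q := lambdaq_ge1 _ hq.
    by split => /=; apply/andP; split => //; nra.
  by split => //=; rewrite s0 (lt_le_trans s1) // Rq_ge1.
have lebB : leb3 B = (4^-1)%:E.
  have h : leb I = 2^-1%:E.
    rewrite /I lebesgue_measure_itv /= lte_fin invf_lt1 // ltr1n -EFinB.
    by congr (_%:E); field.
  have h' : leb J = 1%:E.
    by rewrite /J lebesgue_measure_itv /= lte_fin ltr01 sube0.
  transitivity (leb2 (I `*` I) * leb J)%E.
    by apply: sfprodE => //; exact: measurableX.
  rewrite h' mule1; transitivity (leb I * leb I)%E; first exact: sfprodE.
  by rewrite h -EFinM; congr (_%:E); field.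
apply/andP; split.
  have BYle : (leb3 B <= leb3 (Yq R q))%E by apply: le_measure; rewrite ?inE.
  by apply: lt_le_trans BYle; rewrite lebB lte_fin invr_gt0.
rewrite ltey; apply/eqP => Yoo.
have := leb3_proportional _ mB BY; rewrite Yoo lebB => e.
have := measure_ge0 mu' B; rewrite le_eqVlt => /orP[/eqP b0|b0].
  by move: e; rewrite -b0 mule0 => -[] /eqP; rewrite invr_eq0 pnatr_eq0.
by move: e; rewrite gt0_mulye.
Qed.

End HaarUniqueness.

(** * The roof function and the volume of the suspension *)

Section Roof.
Context {R : realType}.
Variables (q : nat) (hq : (3 <= q)%N).
Local Notation leb := (@lebesgue_measure R).
Local Notation leb2 := (sfprod leb leb).
Local Notation leb3 := (sfprod leb2 leb).
Local Notation V2 := (measurableTypeR R * measurableTypeR R)%type.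

Lemma xsection_Yq (ab : V2) :
  leb (xsection (Yq R q) ab) = ((EFin \o Rq R q) \_ (Tq R q) ab)%E.
Proof.
rewrite patchE; case: ifPn => [/set_mem Tab|/negP nT].
  have R1 := Rq_ge1 _ hq _ Tab.
  have -> : xsection (Yq R q) ab = `[0, Rq R q ab[%classic.
    apply/seteqP; split => s; rewrite /xsection /= inE in_itv /=.
      by case.
    by split.
  rewrite lebesgue_measure_itv /= lte_fin (lt_le_trans ltr01 R1).
  by rewrite -EFinB subr0.
rewrite (_ : xsection _ _ = set0) ?measure0 //; apply/seteqP; split => // s.
by rewrite /xsection /= inE => -[/mem_set].
Qed.

Lemma integral_Rq : (\int[leb2]_(x in Tq R q) (Rq R q x)%:E = leb3 (Yq R q))%E.
Proof.
rewrite integral_mkcond /sfprod [RHS]/product_measure1; apply: eq_integral => x _.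
by rewrite /= xsection_Yq.
Qed.

Lemma measurable_Rq : measurable_fun (Tq R q : set V2) (EFin \o Rq R q).
Proof.
apply/(measurable_restrictT _ (@measurable_Tq R q)).
rewrite (_ : _ \_ _ = leb \o xsection (Yq R q)); last first.
  by apply/funext => x /=; rewrite xsection_Yq.
by apply: measurable_fun_xsection; exact: measurable_Yq.
Qed.

End Roof.

Theorem mainTheorem9 (R : realType) (q : nat) (hq : (3 <= q)%N)
  (mu : probability (XqM R q) R) (hmu : SL2inv_prob R q mu) :
  let leb2 := (@lebesgue_measure R \x @lebesgue_measure R)%E in
  let leb3 := ((@lebesgue_measure R \x @lebesgue_measure R) \x @lebesgue_measure R)%E in
  let mq_R : R := (2 / lambdaq R q) * fine (\int[leb2]_(x in Tq R q) (Rq R q x)%:E)%E in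
  let nu (B : set ((R * R) * R)) : \bar R :=
    ((2 / lambdaq R q / mq_R)%:E * leb3 (B `&` Yq R q))%E in
  [/\ leb2.-integrable (Tq R q) (EFin \o Rq R q),
      exists E : set (XqM R q),
        [/\ measurable E, mu E = 1%E,
            (forall t : R, hX R q t @` E = E),
            Phiq R q @` Yq R q = E &
            (forall y y', Yq R q y -> Yq R q y' -> Phiq R q y = Phiq R q y' -> y = y')],
      (forall t : R, 0 <= t -> forall y, Yq R q y ->
          (exists y', suspflow R q t y y') /\
          (forall y', suspflow R q t y y' -> Phiq R q y' = hX R q t (Phiq R q y))),
      measurable_fun (Yq R q) (Phiq R q) &
      (forall A : set (XqM R q), measurable A -> nu (Phiq R q @^-1` A) = mu A)].
Proof.
move=> leb2 leb3 mq_R nu.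
have [mu' mu'E] := section_measure q hq mu.
have mY : measurable (Yq R q) := measurable_Yq q hq.
have mPhi : measurable_fun (Yq R q) (Phiq R q).
  move=> _ A mA; have := measurableI _ _ mY (measurable_Phiq_preimage q A mA).
  suff -> : Yq R q `&` (Phiq R q @^-1` A `&` [set y | y.1.1 != 0]) =
      Yq R q `&` Phiq R q @^-1` A by [].
  apply/seteqP; split => y [Yy]; first by case.
  by move=> Ay; split => //; split => //; exact: (Yq_neq0 q).
have mE : measurable (Phiq R q @` Yq R q : set (XqM R q)).
  by apply: measurable_Phiq_image => // y /Yq_neq0.
have muE : mu (Phiq R q @` Yq R q) = 1%E by exact: mu_Phiq_image.
have /andP[Y0 Yoo] := leb3_Yq q hq mu hmu mu' mu'E.
rewrite -[sfprod _ _]/leb3 in Y0 Yoo.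
have intR : (\int[leb2]_(x in Tq R q) (Rq R q x)%:E = leb3 (Yq R q))%E.
  exact: integral_Rq.
split => //.
- apply/integrableP; split; first exact: measurable_Rq.
  suff e : (\int[leb2]_(x in Tq R q) `|(EFin \o Rq R q) x| = leb3 (Yq R q))%E.
    by rewrite e.
  rewrite -intR; apply: eq_integral => x /set_mem Tx /=; congr (_%:E); rewrite ger0_norm //.
  by apply: le_trans (Rq_ge1 _ hq _ Tx).
- exists (Phiq R q @` Yq R q); split => //; last exact: Phiq_inj.
  (* The image consists of the lattices having a slope in the strip, and [h_t] only translates
     slopes. Applying this inclusion to [- t] gives the reverse one. *)
  have hE t : hX R q t @` (Phiq R q @` Yq R q) `<=` Phiq R q @` Yq R q.
    move=> _ [x Ex <-]; have [g dg xE] := Xq_repr q x; move: Ex; rewrite {}xE.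
    move=> /(Phiq_image _ hq _ dg) [s sg].
    have dhg : \det (hmat R t * g) = 1 by rewrite detM det_hmat dg mulr1.
    rewrite /hX actX_toX //; apply/(Phiq_image _ hq _ dhg).
    by exists (s - t); apply/slopeset_h; rewrite subrK.
  move=> t; apply/seteqP; split; first exact: hE.
  move=> x Ex; exists (hX R q (- t) x); first by apply: (hE (- t)); exists x.
  have [g dg ->] := Xq_repr q x.
  have dhg : \det (hmat R (- t) * g) = 1 by rewrite detM det_hmat dg mulr1.
  by rewrite /hX !actX_toX // mulrA hmatD subrr hmat0 mul1r.
- move=> t t0 y Yy; split; first exact: suspflow_exists.
  by move=> y'; exact: Phiq_suspflow.
- move=> A mA; rewrite /nu.
  have mC : measurable (Phiq R q @^-1` A `&` Yq R q) by rewrite setIC; exact: mPhi.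
  have CY : Phiq R q @^-1` A `&` Yq R q `<=` Yq R q by move=> y [].
  (* Proportionality gives the measure of the part of [A] in the image of [Phiq]; the rest of [A] is
     null because the image has full measure. *)
  have -> : leb3 (Phiq R q @^-1` A `&` Yq R q) = (leb3 (Yq R q) * mu A)%E.
    transitivity (leb3 (Yq R q) * mu' (Phiq R q @^-1` A `&` Yq R q))%E.
      exact: (leb3_proportional q hq mu hmu mu' mu'E).
    congr (_ * _)%E; rewrite mu'E //.
    have -> : Phiq R q @` (Phiq R q @^-1` A `&` Yq R q) = A `&` Phiq R q @` Yq R q.
      apply/seteqP; split => x; first by move=> [y [Ay Yy] <-]; split => //; exists y.
      by move=> [Ax [y Yy yx]]; exists y => //; split => //=; rewrite yx.
    have muEC : mu (~` (Phiq R q @` Yq R q)) = 0%E.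
      by rewrite probability_setC // muE subee.
    apply/eqP; rewrite eq_le; apply/andP; split.
      by apply: le_measure; rewrite ?inE //; exact: measurableI.
    rewrite -{1}(setIT A) -(setUv (Phiq R q @` Yq R q)) setIUr.
    apply: le_trans (measureU2 _ _ _) _; rewrite ?inE //; try exact: measurableI.
      by apply: measurableI => //; exact: measurableC.
    rewrite -[leRHS]adde0 leeD // -muEC; apply: le_measure; rewrite ?inE //.
      by apply: measurableI => //; exact: measurableC.
    exact: measurableC.
  rewrite muleA -[RHS]mul1e; congr (_ * _)%E.
  have fY : (fine (leb3 (Yq R q)))%:E = leb3 (Yq R q).
    by rewrite fineK // ge0_fin_numE // ltW.
  have f0 : 0 < fine (leb3 (Yq R q)) by rewrite -lte_fin fY.
  (* Since [mq_R] is [2 / lam] times the volume of [Yq], the normalizing constant of [nu] is the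
     inverse of that volume. *)
  rewrite /mq_R intR -fY -EFinM; congr (_%:E) => /=.
  have l0 : lambdaq R q != 0.
    by rewrite gt_eqF // (lt_le_trans ltr01) // (lambdaq_ge1 _ hq).
  by field; rewrite l0 (gt_eqF f0).
Qed.
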